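(* Let $W$ be a restricted $\mathcal{L}^*$-module of level $\ell_{1234}$. Then there exists a $\phi$-coordinated $V_{\widehat{\mathfrak{L}^*}}(\ell_{1234},0)$-module structure $Y_W(\cdot,x)$ on $W$, uniquely determined by $$Y_W((T^m)_{-1}\mathbf{1},x)=T_m(x),\qquad Y_W((E^m)_{-1}\mathbf{1},x)=E_m(x)\qquad(m\in\mathbb{Z}).$$
   Context: The rank two twisted Heisenberg–Virasoro algebra $\mathcal{L}^*$ has basis $\{t_1^mt_2^n, E_{m,n}: (m,n)\in\mathbb{Z}^2\setminus\{(0,0)\}\}\cup\{K_1,K_2,K_3,K_4\}$, $K_i$ central, with $[t_1^mt_2^n,t_1^rt_2^s]=0$, $[t_1^mt_2^n,E_{r,s}]=(nr-ms)t_1^{m+r}t_2^{n+s}+\delta_{m+r,0}\delta_{n+s,0}(mK_1+nK_2)$, $[E_{m,n},E_{r,s}]=(nr-ms)E_{m+r,n+s}+\delta_{m+r,0}\delta_{n+s,0}(mK_3+nK_4)$ (terms with index $(0,0)$ are interpreted as $0$). Set $T_m(x)=\sum_{n\in\mathbb{Z}}t_1^mt_2^nx^{-n}$ and $E_m(x)=\sum_nE_{m,n}x^{-n}$ (omitting $(0,0)$ terms). An $\mathcal{L}^*$-module $W$ is restricted if $T_m(x),E_m(x)\in\mathrm{Hom}(W,W((x)))$ for all $m$, i.e. for each $w$, $t_1^mt_2^nw=0$ and $E_{m,n}w=0$ for $n$ sufficiently large; it has level $\ell_{1234}$ if $K_i$ acts as $\ell_i\in\mathbb{C}$. $\widehat{\mathfrak{L}^*}$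 is the Lie algebra with basis $\{T^m\otimes t^n, E^r\otimes t^s:(m,n),(r,s)\in\mathbb{Z}^2\}\cup\{K_1,\dots,K_4\}$, $K_i$ central, $[T^m\otimes t^n,T^r\otimes t^s]=0$, $[T^m\otimes t^n,E^r\otimes t^s]=(nr-ms)T^{m+r}\otimes t^{n+s-1}+m\delta_{m+r,0}\delta_{n+s+1,0}K_1+n\delta_{m+r,0}\delta_{n+s,0}K_2$, $[E^m\otimes t^n,E^r\otimes t^s]=(nr-ms)E^{m+r}\otimes t^{n+s-1}+m\delta_{m+r,0}\delta_{n+s+1,0}K_3+n\delta_{m+r,0}\delta_{n+s,0}K_4$. Write $(T^m)_n=T^m\otimes t^n$, $(E^r)_s=E^r\otimes t^s$. $V_{\widehat{\mathfrak{L}^*}}(\ell_{1234},0)=U(\widehat{\mathfrak{L}^*})\otimes_{U(\widehat{\mathfrak{L}^*}_{\ge0})}\mathbb{C}$, where $\widehat{\mathfrak{L}^*}_{\ge0}$ is spanned by $T^m\otimes t^n,E^r\otimes t^n$ ($n\ge0$) acting as $0$ and $K_i$ acting as $\ell_i$; $\mathbf{1}=1\otimes1$. It is a vertex algebra with vacuum $\mathbf{1}$, $Y((T^m)_{-1}\mathbf{1},x)=\sum_n(T^m)_nx^{-n-1}$, $Y((E^r)_{-1}\mathbf{1},x)=\sum_s(E^r)_sx^{-s-1}$, generated by $\{(T^m)_{-1}\mathbf{1},(E^r)_{-1}\mathbf{1}\}$. A $\phi$-coordinated module ($\phi(x,z)=xe^z$) for a vertex algebra $V$ is a space $W$ with a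 linear map $Y_W(\cdot,x):V\to\mathrm{Hom}(W,W((x)))$ such that $Y_W(\mathbf{1},x)=\mathbf{1}_W$ and for $u,v\in V$ there is $k\in\mathbb{N}$ with $(x_1-x_2)^kY_W(u,x_1)Y_W(v,x_2)\in\mathrm{Hom}(W,W((x_1,x_2)))$ and $(x_2e^z-x_2)^kY_W(Y(u,z)v,x_2)=((x_1-x_2)^kY_W(u,x_1)Y_W(v,x_2))|_{x_1=x_2e^z}$. *)

(* Defs.v *)
From HB Require Import structures.
From mathcomp Require Import all_boot all_order all_algebra.
From mathcomp Require Import complex.
From mathcomp Require Import Rstruct.
From Stdlib Require Import Rdefinitions.

Set Implicit Arguments.
Unset Strict Implicit.
Unset Printing Implicit Defensive.

Import Order.TTheory GRing.Theory Num.Theory.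
Local Open Scope ring_scope.

Notation C := (complex Rdefinitions.R).

Definition islin (U V : lmodType C) (f : U -> V) : Prop :=
  forall (a : C) (x y : U), f (a *: x + y) = a *: f x + f y.

Definition kd (a b : int) : C := if a == b then 1 else 0.

Definition zbinom (p : int) (i : nat) : C :=
  (\prod_(j < i) (p%:~R - j%:R)) / (i`!)%:R.

(* Modules for the rank two twisted Heisenberg-Virasoro algebra L^*.         *)
(* A module structure is given by operators tW m n (action of t_1^m t_2^n)   *)
(* and EW m n (action of E_{m,n}) for (m,n) <> (0,0); the values at (0,0)    *)
(* are irrelevant (never used).  The central elements K_i act as l_i         *)
(* (level l_{1234}), which is built into the bracket relations.              *)

Definition nz (m n : int) : bool := (m != 0) || (n != 0).

Definition tz (W : lmodType C) (tW : int -> int -> W -> W) (m n : int) (w : W) : W :=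
  if nz m n then tW m n w else 0.

Definition Lstar_module (l1 l2 l3 l4 : C) (W : lmodType C)
    (tW EW : int -> int -> W -> W) : Prop :=
  (forall m n, islin (tW m n)) /\ (forall m n, islin (EW m n)) /\
  (forall m n r s w, nz m n -> nz r s ->
     tW m n (tW r s w) - tW r s (tW m n w) = 0) /\
  (forall m n r s w, nz m n -> nz r s ->
     tW m n (EW r s w) - EW r s (tW m n w) =
       (n * r - m * s)%:~R *: tz tW (m + r) (n + s) w
       + (kd (m + r) 0 * kd (n + s) 0 * (m%:~R * l1 + n%:~R * l2)) *: w) /\
  (forall m n r s w, nz m n -> nz r s ->
     EW m n (EW r s w) - EW r s (EW m n w) =
       (n * r - m * s)%:~R *: tz EW (m + r) (n + s) w
       + (kd (m + r) 0 * kd (n + s) 0 * (m%:~R * l3 + n%:~R * l4)) *: w).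

(* restricted: T_m(x), E_m(x) in Hom(W, W((x))) *)
Definition restricted (W : lmodType C) (tW EW : int -> int -> W -> W) : Prop :=
  forall (m : int) (w : W), exists N : int, forall n : int, N <= n ->
    tW m n w = 0 /\ EW m n w = 0.

(* Modules for the Lie algebra \hat{L^*} of level l_{1234}:                  *)
(* TV m n = action of T^m (x) t^n,  EV r s = action of E^r (x) t^s.          *)

Definition Lhat_module (l1 l2 l3 l4 : C) (M : lmodType C)
    (TV EV : int -> int -> M -> M) : Prop :=
  (forall m n, islin (TV m n)) /\ (forall m n, islin (EV m n)) /\
  (forall m n r s w, TV m n (TV r s w) - TV r s (TV m n w) = 0) /\
  (forall m n r s w,
     TV m n (EV r s w) - EV r s (TV m n w) =
       (n * r - m * s)%:~R *: TV (m + r) (n + s - 1) w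
       + (m%:~R * kd (m + r) 0 * kd (n + s + 1) 0 * l1
          + n%:~R * kd (m + r) 0 * kd (n + s) 0 * l2) *: w) /\
  (forall m n r s w,
     EV m n (EV r s w) - EV r s (EV m n w) =
       (n * r - m * s)%:~R *: EV (m + r) (n + s - 1) w
       + (m%:~R * kd (m + r) 0 * kd (n + s + 1) 0 * l3
          + n%:~R * kd (m + r) 0 * kd (n + s) 0 * l4) *: w).

(* w is annihilated by \hat{L^*}_{>=0} (apart from the K_i, acting as l_i) *)
Definition nonneg_annihilated (M : lmodType C) (TV EV : int -> int -> M -> M)
    (w : M) : Prop :=
  forall m n : int, 0 <= n -> TV m n w = 0 /\ EV m n w = 0.

(* (V, TV, EV, vac) is the induced module
     V_{\hat{L^*}}(l_{1234},0) = U(\hat{L^*}) (x)_{U(\hat{L^*}_{>=0})} C,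
   vac = 1 (x) 1, characterized by its universal property: for every
   \hat{L^*}-module M of level l_{1234} and every w in M annihilated by
   \hat{L^*}_{>=0}, there is a unique module homomorphism V -> M sending
   vac to w. *)
Definition vacuum_module (l1 l2 l3 l4 : C) (V : lmodType C)
    (TV EV : int -> int -> V -> V) (vac : V) : Prop :=
  Lhat_module l1 l2 l3 l4 TV EV /\ nonneg_annihilated TV EV vac /\
  forall (M : lmodType C) (TM EM : int -> int -> M -> M) (w : M),
    Lhat_module l1 l2 l3 l4 TM EM -> nonneg_annihilated TM EM w ->
    (exists f : V -> M, islin f /\ f vac = w /\
        (forall m n v, f (TV m n v) = TM m n (f v)) /\
        (forall m n v, f (EV m n v) = EM m n (f v))) /\
    (forall f g : V -> M,
        islin f -> f vac = w ->
        (forall m n v, f (TV m n v) = TM m n (f v)) ->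
        (forall m n v, f (EV m n v) = EM m n (f v)) ->
        islin g -> g vac = w ->
        (forall m n v, g (TV m n v) = TM m n (g v)) ->
        (forall m n v, g (EV m n v) = EM m n (g v)) ->
        forall v, f v = g v).

(* Vertex algebras.  YV u n v = u_n v, where Y(u,x) = \sum_n u_n x^{-n-1}.   *)

Definition vertex_algebra (V : lmodType C) (vac : V) (YV : V -> int -> V -> V)
    : Prop :=
  (* Y(.,x) is a linear map V -> Hom(V, V((x))) *)
  (forall n v, islin (fun u => YV u n v)) /\
  (forall u n, islin (YV u n)) /\
  (forall u v, exists N : int, forall n : int, N <= n -> YV u n v = 0) /\
  (forall n v, YV vac n v = if n == -1 then v else 0) /\
  (forall u n, 0 <= n -> YV u n vac = 0) /\
  (forall u, YV u (-1) vac = u) /\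
  (* Jacobi identity, in component (Borcherds) form; all sums are finite
     once N is beyond the truncation bounds *)
  (forall (u v w : V) (p q r : int) (N : nat),
     (forall i : nat, leq N i ->
        YV u (r + i%:Z) v = 0 /\ YV v (q + i%:Z) w = 0 /\ YV u (p + i%:Z) w = 0) ->
     \sum_(i < N) zbinom p i *: YV (YV u (r + i%:Z) v) (p + q - i%:Z) w =
     \sum_(i < N) ((-1) ^+ i * zbinom r i) *:
        (YV u (p + r - i%:Z) (YV v (q + i%:Z) w)
         - (-1) ^ r *: YV v (q + r - i%:Z) (YV u (p + i%:Z) w))).

(* phi-coordinated modules, phi(x,z) = x e^z.                                *)
(* YW v n w = coefficient of x^n in Y_W(v,x) w.                              *)

(* coefficient of x1^a x2^b in (x1 - x2)^k Y_W(u,x1) Y_W(v,x2) w *)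
Definition prod_coef (V W : lmodType C) (YW : V -> int -> W -> W)
    (k : nat) (u v : V) (w : W) (a b : int) : W :=
  \sum_(p < k.+1) ('C(k, p)%:R * (-1) ^+ (k - p)) *:
      YW u (a - p%:Z) (YW v (b - k%:Z + p%:Z) w).

(* coefficient of x2^c z^r (r >= 0) in  F(x2 e^z, x2), for
   F = \sum_{a,b >= N} F_{a,b} x1^a x2^b :
     (1/r!) \sum_{a+b=c, a,b >= N} a^r F_{a,b} *)
Definition subst_coef (W : lmodType C) (F : int -> int -> W) (N c : int) (r : nat)
    : W :=
  (r`!%:R)^-1 *:
    \sum_(i < absz (c - 2 * N + 1) | (i%:Z <= c - 2 * N))
        ((N + i%:Z)%:~R ^+ r) *: F (N + i%:Z) (c - N - i%:Z).

(* coefficient of x2^c z^q in (x2 e^z - x2)^k Y_W(Y(u,z)v, x2) w, where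
   (x2 e^z - x2)^k = x2^k \sum_p binom(k,p) (-1)^(k-p) e^{pz} and
   Y(u,z)v = \sum_n u_n v z^{-n-1} with u_n v = 0 for n >= M *)
Definition assoc_coef (V W : lmodType C) (YV : V -> int -> V -> V)
    (YW : V -> int -> W -> W) (k : nat) (u v : V) (w : W) (M c q : int) : W :=
  \sum_(p < k.+1) ('C(k, p)%:R * (-1) ^+ (k - p)) *:
    \sum_(j < absz (q + M + 1) | (j%:Z < q + M + 1))
       ((j`!%:R)^-1 * (p%:R ^+ j)) *:
          YW (YV u (j%:Z - q - 1) v) (c - k%:Z) w.

Definition phi_coordinated_module (V W : lmodType C) (vac : V)
    (YV : V -> int -> V -> V) (YW : V -> int -> W -> W) : Prop :=
  (* Y_W(.,x) is a linear map V -> Hom(W, W((x))) *)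
  (forall n w, islin (fun v => YW v n w)) /\
  (forall v n, islin (YW v n)) /\
  (forall v w, exists N : int, forall n : int, n < N -> YW v n w = 0) /\
  (forall n w, YW vac n w = if n == 0 then w else 0) /\
  (forall u v : V, exists k : nat, forall w : W,
     exists N : int,
       (* (x1-x2)^k Y_W(u,x1)Y_W(v,x2) w in W((x1,x2)) *)
       (forall a b : int, (a < N) || (b < N) -> prod_coef YW k u v w a b = 0) /\
       (* (x2 e^z - x2)^k Y_W(Y(u,z)v,x2) w
            = ((x1-x2)^k Y_W(u,x1)Y_W(v,x2) w)|_{x1 = x2 e^z} *)
       (forall M : int, (forall n : int, M <= n -> YV u n v = 0) ->
         forall c q : int,
           assoc_coef YV YW k u v w M c q =
           if q < 0 then 0
           else subst_coef (prod_coef YW k u v w) N c (absz q))).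

(* the generating-field conditions
     Y_W((T^m)_{-1} 1, x) = T_m(x) = \sum_n t_1^m t_2^n x^{-n},
     Y_W((E^m)_{-1} 1, x) = E_m(x) = \sum_n E_{m,n} x^{-n}   ((0,0) omitted) *)
Definition generating_fields (V W : lmodType C) (TV EV : int -> int -> V -> V)
    (vac : V) (tW EW : int -> int -> W -> W) (YW : V -> int -> W -> W) : Prop :=
  forall (m n : int) (w : W),
    YW (TV m (-1) vac) n w = tz tW m (- n) w /\
    YW (EV m (-1) vac) n w = tz EW m (- n) w.

(* Main.v *)
(** A field on [W] is [a(x) = \sum_n a_n x^n] in [Hom(W, W((x)))].  For local
    fields the normally ordered product
    [N_t(a, c) = \sum_(i >= t) x^i a_i c(x) + \sum_(i < t) c(x) x^i a_i]
    satisfies [N_t - N_(t+1) = x^t [a_t, c(x)]] and is polynomial in [t].  The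
    products [a_n c] that a coordinated module structure forces are defined by
    [N_t(a, c) = Res_z e^(-t z) kappa(z) \sum_n (a_n c) z^(-n-1)] with
    [kappa = 1 / (1 - e^(-z))], together with [(x a')_n c = - n a_(n-1) c].
    Computing [[N_s(a, .), N_t(b, .)]] directly and comparing kernels yields
    Borcherds' commutator formula for these products; together with Dong's lemma,
    which bounds the degree in [t] by finite differences, this makes the fields
    local to all [T_m(x)], [E_m(x)] into an [\hat{L^*}]-module in which the
    identity is a vacuum vector.  The universal property of [V] then gives a map
    [v |-> Y_W(v, x)].  It carries [u_n v] to [Y_W(u)_n Y_W(v)], by induction on
    [v]: both sides obey the same commutator formula with the generators, and at
    the vacuum both are iterated derivatives.  Associativity for [x_1 = x_2 e^z]
    follows since [z^(-1) - kappa] is a power series, and uniqueness since the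
    residues against [z^(-q-1) (e^z - 1)^k] determine the modes. *)

Require Import Defs.
From HB Require Import structures.
From mathcomp Require Import all_boot all_order all_algebra.
From mathcomp Require Import complex Rstruct.
From mathcomp Require Import boolp classical_sets functions fsbigop ring zify.

Set Implicit Arguments.
Unset Strict Implicit.
Unset Printing Implicit Defensive.

Import Order.TTheory GRing.Theory Num.Theory.
Local Open Scope ring_scope.

Reserved Notation "\zsum_ i F"
  (at level 34, i at level 0, F at level 41, format "'[' \zsum_ i '/  '  F ']'").

(** * Sums over the integers *)

Definition zsum (M : zmodType) (f : int -> M) : M := \sum_(i \in [set: int]%classic) f i.
Notation "\zsum_ i F" := (zsum (fun i => F)) : ring_scope.

Definition bounded_supp (M : zmodType) (f : int -> M) : Prop :=
  exists lo hi : int, forall i, (i < lo) || (hi <= i) -> f i = 0.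

Section IntegerSums.
Variable M : zmodType.
Implicit Types f g : int -> M.

Lemma eq_zsum f g : f =1 g -> zsum f = zsum g.
Proof. by move=> fg; congr zsum; apply: funext. Qed.

Lemma zsum_ord (lo : int) (n : nat) f :
  (forall i, (i < lo) || (lo + n%:Z <= i) -> f i = 0) ->
  zsum f = \sum_(k < n) f (lo + k%:Z).
Proof.
move=> f0; pose window := [seq lo + k%:Z | k <- index_iota 0 n].
transitivity (\sum_(i <- window) f i); last by rewrite big_map big_mkord.
apply/esym; rewrite (@bigfs _ _ _ _ window xpredT) ?/zsum => [|| i _ out].
- by congr (\sum_(i \in _) _); apply/seteqP; split.
- by rewrite map_inj_uniq ?iota_uniq // => j k /addrI[].
- apply/f0/contraT => /norP[lo_i i_hi]; case/mapP: out.
  by exists (absz (i - lo)%R); rewrite ?mem_index_iota; lia.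
Qed.

Lemma bounded_supp_ord f : bounded_supp f ->
  exists (lo : int) (n : nat), forall i, (i < lo) || (lo + n%:Z <= i) -> f i = 0.
Proof. by case=> lo [hi f0]; exists lo, (absz (hi - lo)%R) => i ?; apply: f0; lia. Qed.

Lemma zsum0 f : (forall i, f i = 0) -> zsum f = 0.
Proof. by move=> f0; apply: fsbig1. Qed.

Lemma zsum_single (k : int) f : (forall i, i != k -> f i = 0) -> zsum f = f k.
Proof.
move=> f0; rewrite (@zsum_ord k 1) ?big_ord1 ?addr0 // => i hi.
by apply: f0; lia.
Qed.

Lemma bounded_supp_if (lo hi : int) f : bounded_supp (fun i => if lo <= i < hi then f i else 0).
Proof. by exists lo, hi => i hi'; rewrite ifF //; lia. Qed.

Lemma bounded_suppD f g : bounded_supp f -> bounded_supp g ->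
  bounded_supp (fun i => f i + g i).
Proof.
move=> [l [h f0]] [l' [h' g0]]; exists (Num.min l l'), (Num.max h h') => i hi.
by rewrite f0 ?g0 ?addr0 //; lia.
Qed.

Lemma zsumD f g : bounded_supp f -> bounded_supp g ->
  \zsum_i (f i + g i) = zsum f + zsum g.
Proof.
move=> [l [h f0]] [l' [h' g0]].
pose lo := Num.min l l'; pose n := absz (Num.max h h' - lo)%R.
rewrite !(@zsum_ord lo n) ?big_split // => i hi; rewrite ?f0 ?g0 ?addr0 //; lia.
Qed.

Lemma bounded_supp_shift k f : bounded_supp f -> bounded_supp (fun i => f (i + k)).
Proof. by case=> l [h f0]; exists (l - k), (h - k) => i hi; apply: f0; lia. Qed.

Lemma zsum_shift k f : \zsum_i f (i + k) = zsum f.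
Proof.
by rewrite [RHS](reindex_fsbigT (+%R^~ k)) //; exists (+%R^~ (- k)) => i; rewrite ?addrK ?subrK.
Qed.

Lemma zsum_rev k f : \zsum_i f (k - i) = zsum f.
Proof.
by rewrite [RHS](reindex_fsbigT (fun i => k - i)) //; exists (fun i => k - i) => i; rewrite subKr.
Qed.

Lemma bounded_supp_sum (n : nat) (F : nat -> int -> M) :
  (forall k, bounded_supp (F k)) -> bounded_supp (fun i => \sum_(k < n) F k i).
Proof.
move=> hF; elim: n => [|n IH]; first by exists 0, 0 => i _; rewrite big_ord0.
by under eq_fun do rewrite big_ord_recr /=; exact: bounded_suppD.
Qed.

Lemma zsum_sum (n : nat) (F : nat -> int -> M) : (forall k, bounded_supp (F k)) ->
  \zsum_i \sum_(k < n) F k i = \sum_(k < n) zsum (F k).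
Proof.
move=> hF; elim: n => [|n IH]; first by rewrite big_ord0 zsum0 // => i; rewrite big_ord0.
under eq_zsum do rewrite big_ord_recr /=.
by rewrite big_ord_recr zsumD ?IH //; exact: bounded_supp_sum.
Qed.

End IntegerSums.

Section Morphisms.
Variables (M N : zmodType) (g : M -> N).

Lemma bounded_supp_comp (f : int -> M) : g 0 = 0 ->
  bounded_supp f -> bounded_supp (fun i => g (f i)).
Proof. by move=> g0 [l [h f0]]; exists l, h => i /f0 ->. Qed.

Lemma zsum_morph (f : int -> M) : {morph g : x y / x + y} -> bounded_supp f ->
  \zsum_i g (f i) = g (zsum f).
Proof.
move=> gD hf; have g0 : g 0 = 0 by apply: (addrI (g 0)); rewrite -gD !addr0.
have [lo [n f0]] := bounded_supp_ord hf.
rewrite !(@zsum_ord _ lo n) // => [|i /f0 -> //].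
by rewrite (big_morph g gD g0).
Qed.

End Morphisms.

Section Opposite.
Variable M : zmodType.
Implicit Types f g : int -> M.

Lemma bounded_suppN f : bounded_supp f -> bounded_supp (fun i => - f i).
Proof. exact: (bounded_supp_comp (oppr0 M)). Qed.

Lemma zsumN f : bounded_supp f -> \zsum_i (- f i) = - zsum f.
Proof. by apply: zsum_morph; exact: opprD. Qed.

Lemma zsumB f g : bounded_supp f -> bounded_supp g ->
  \zsum_i (f i - g i) = zsum f - zsum g.
Proof. by move=> hf hg; rewrite zsumD ?zsumN //; exact: bounded_suppN. Qed.

End Opposite.

Section Scaling.
Variables (R : pzRingType) (M : lmodType R).
Implicit Type f : int -> M.

Lemma bounded_suppZ (k : R) f : bounded_supp f -> bounded_supp (fun i => k *: f i).
Proof. exact: (bounded_supp_comp (scaler0 M k)). Qed.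

Lemma zsumZ (k : R) f : bounded_supp f -> \zsum_i (k *: f i) = k *: zsum f.
Proof. by apply: zsum_morph; exact: scalerDr. Qed.

End Scaling.

Section DoubleSums.
Variable M : zmodType.
Implicit Types F G : int -> int -> M.

Definition bounded_supp2 F : Prop := exists lo hi : int,
  forall i j, [|| i < lo, hi <= i, j < lo | hi <= j] -> F i j = 0.

Lemma bounded_supp2_row F i : bounded_supp2 F -> bounded_supp (F i).
Proof. by case=> l [h F0]; exists l, h => j hj; apply: F0; lia. Qed.

Lemma bounded_supp2_zsum F : bounded_supp2 F -> bounded_supp (fun i => zsum (F i)).
Proof. by case=> l [h F0]; exists l, h => i hi; apply: zsum0 => j; apply: F0; lia. Qed.

Lemma bounded_supp2_swap F : bounded_supp2 F -> bounded_supp2 (fun i j => F j i).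
Proof. by case=> l [h F0]; exists l, h => i j hij; apply: F0; lia. Qed.

Lemma bounded_supp2_shear F : bounded_supp2 F -> bounded_supp2 (fun i j => F i (j - i)).
Proof.
case=> l [h F0]; exists (Num.min l (l + l)), (Num.max h (h + h)) => i j hij.
by apply: F0; lia.
Qed.

Lemma zsum_exchange F : bounded_supp2 F ->
  \zsum_i \zsum_j F i j = \zsum_j \zsum_i F i j.
Proof.
move=> hF; have [l [h F0]] := hF; pose n := absz (h - l)%R.
have ordE G : (forall i j, [|| i < l, h <= i, j < l | h <= j] -> G i j = 0) ->
    \zsum_i \zsum_j G i j = \sum_(i < n) \sum_(j < n) G (l + i%:Z) (l + j%:Z).
  move=> G0; rewrite (@zsum_ord _ l n) => [|i hi]; last first.
    by apply: zsum0 => j; apply: G0; lia.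
  by apply: eq_bigr => i _; apply: zsum_ord => j hj; apply: G0; lia.
by rewrite (ordE F) // (ordE (fun j i => F i j)) 1?exchange_big // => i j hij; apply: F0; lia.
Qed.

Lemma zsum_shear F : bounded_supp2 F ->
  \zsum_i \zsum_j F i j = \zsum_k \zsum_i F i (k - i).
Proof.
move=> hF; rewrite -(zsum_exchange (bounded_supp2_shear hF)).
by apply: eq_zsum => i; rewrite -[LHS](@zsum_shift _ (- i)).
Qed.

End DoubleSums.

Lemma zsum_telescope (M : zmodType) (p q : int -> M) (lo hi : int) : lo <= hi ->
  (forall x, p (x + 1) - p x = q x) ->
  \zsum_i (if lo <= i < hi then q i else 0) = p hi - p lo.
Proof.
move=> lohi pq; pose n := absz (hi - lo)%R.
rewrite (@zsum_ord _ lo n) => [|i ?]; last by rewrite ifF //; lia.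
transitivity (\sum_(0 <= k < n) (p (lo + k.+1%:Z) - p (lo + k%:Z))).
  rewrite big_mkord; apply: eq_bigr => k _; rewrite ifT -?pq; last by case: k => k /=; lia.
  by congr (p _ - _); lia.
by rewrite (telescope_sumr (fun k => p (lo + k%:Z))) // addr0; congr (p _ - _); lia.
Qed.

(** * Formal Laurent series *)

Definition order_ge (M : zmodType) (A : int) (f : int -> M) : Prop :=
  forall n, n < A -> f n = 0.

Section LaurentSeries.
Variable R : comNzRingType.

Definition bounded_below : {pred int -> R} :=
  [pred f | `[< exists A, order_ge A f >]].

Lemma bounded_below_zmod_closed : zmod_closed bounded_below.
Proof.
split=> [|f g /asboolP[A hf] /asboolP[B hg]]; apply/asboolP; first by exists 0.
by exists (Num.min A B) => n hn; rewrite !fctE hf ?hg ?subr0 //; lia.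
Qed.
HB.instance Definition _ :=
  GRing.isZmodClosed.Build (int -> R) bounded_below bounded_below_zmod_closed.

Record laurent := Laurent { lcoef :> int -> R; lcoef_bounded : lcoef \in bounded_below }.

HB.instance Definition _ := [isSub for lcoef].
HB.instance Definition _ := [Choice of laurent by <:].
HB.instance Definition _ := [SubChoice_isSubZmodule of laurent by <:].

Implicit Types f g h : laurent.

Lemma laurentP f g : (forall n, f n = g n) -> f = g.
Proof. by move=> fg; apply/val_inj/funext. Qed.

Lemma lcoefD f g n : (f + g) n = f n + g n. Proof. by []. Qed.
Lemma lcoefN f n : (- f) n = - f n. Proof. by []. Qed.
Lemma lcoefB f g n : (f - g) n = f n - g n. Proof. by []. Qed.

Lemma laurent_order f : exists A, order_ge A f.
Proof. exact/asboolP/lcoef_bounded. Qed.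

Lemma order_ge_laurent (A : int) (f : int -> R) : order_ge A f -> f \in bounded_below.
Proof. by move=> hf; apply/asboolP; exists A. Qed.

Lemma bounded_supp_conv f g n : bounded_supp (fun i => f i * g (n - i)).
Proof.
have [A hA] := laurent_order f; have [B hB] := laurent_order g.
exists A, (n - B + 1) => i /orP[hi|hi]; first by rewrite hA ?mul0r.
by rewrite hB ?mulr0 //; lia.
Qed.

Definition conv f g (n : int) : R := \zsum_i f i * g (n - i).

Lemma order_ge_conv f g A B : order_ge A f -> order_ge B g -> order_ge (A + B) (conv f g).
Proof.
move=> hf hg n hn; apply: zsum0 => i.
have [hi|hi] := ltP i A; first by rewrite hf ?mul0r.
by rewrite hg ?mulr0 //; lia.
Qed.

Lemma conv_bounded f g : conv f g \in bounded_below.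
Proof.
have [A hA] := laurent_order f; have [B hB] := laurent_order g.
exact: order_ge_laurent (order_ge_conv hA hB).
Qed.

Definition lmul f g : laurent := Laurent (conv_bounded f g).

Lemma lmon_bounded (k : int) : (fun n => (n == k)%:R) \in bounded_below.
Proof. by apply: (@order_ge_laurent k) => n hn; rewrite lt_eqF. Qed.

Definition lmon (k : int) : laurent := Laurent (lmon_bounded k).

Lemma lmonE k n : lmon k n = (n == k)%:R. Proof. by []. Qed.

Lemma conv_monE k f n : conv (lmon k) f n = f (n - k).
Proof.
rewrite /conv (@zsum_single _ k) => [|i hi]; first by rewrite lmonE eqxx mul1r.
by rewrite lmonE (negPf hi) mul0r.
Qed.

Lemma lmulC : commutative lmul.
Proof.
move=> f g; apply: laurentP => n /=; rewrite /conv -(zsum_rev n).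
by apply: eq_zsum => i; rewrite mulrC subKr.
Qed.

Lemma bounded_supp2_conv3 f g h n :
  bounded_supp2 (fun i k => f i * (g (k - i) * h (n - k))).
Proof.
have [A hA] := laurent_order f; have [B hB] := laurent_order g.
have [D hD] := laurent_order h.
exists (Num.min A (A + B)), (Num.max (n - D + 1) (n - D - B + 1)) => i k hik.
have [hi|hi] := ltP i A; first by rewrite hA ?mul0r.
have [hj|hj] := ltP (k - i) B; first by rewrite hB ?mul0r ?mulr0.
by rewrite hD ?mulr0 //; lia.
Qed.

Lemma lmulA : associative lmul.
Proof.
move=> f g h; apply: laurentP => n /=; rewrite /conv /= /conv.
transitivity (\zsum_i \zsum_k f i * (g (k - i) * h (n - k))).
  apply: eq_zsum => i; rewrite -(zsum_morph (mulrDr (f i))); last exact: bounded_supp_conv.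
  rewrite -[LHS](@zsum_shift _ (- i)); apply: eq_zsum => k.
  by congr (_ * (_ * h _)); lia.
rewrite (zsum_exchange (bounded_supp2_conv3 f g h n)); apply: eq_zsum => k.
rewrite -(zsum_morph (fun x y => mulrDl x y (h (n - k)))); last exact: bounded_supp_conv.
by apply: eq_zsum => i; rewrite mulrA.
Qed.

Lemma lmul1 : left_id (lmon 0) lmul.
Proof. by move=> f; apply: laurentP => n; rewrite [LHS]conv_monE subr0. Qed.

Lemma lmulDl : left_distributive lmul +%R.
Proof.
move=> f g h; apply: laurentP => n; rewrite lcoefD /= /conv -zsumD; try exact: bounded_supp_conv.
by apply: eq_zsum => i; rewrite mulrDl.
Qed.

Lemma lmon0_neq0 : lmon 0 != 0.
Proof. by apply/eqP => /(congr1 (lcoef^~ 0)) /eqP; rewrite lmonE eqxx oner_eq0. Qed.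

HB.instance Definition _ :=
  GRing.Zmodule_isComNzRing.Build laurent lmulA lmulC lmul1 lmulDl lmon0_neq0.

#[local] Arguments lcoef : simpl never.

Lemma lcoef1 n : (1 : laurent) n = (n == 0)%:R. Proof. by []. Qed.
Lemma lcoefM f g n : (f * g) n = \zsum_i f i * g (n - i). Proof. by []. Qed.
Lemma lcoef_mon k f n : (lmon k * f) n = f (n - k). Proof. exact: conv_monE. Qed.

Lemma lcoef_sum (I : Type) (r : seq I) (P : pred I) (F : I -> laurent) n :
  (\sum_(i <- r | P i) F i) n = \sum_(i <- r | P i) F i n.
Proof. exact: (big_morph (fun f : laurent => f n)). Qed.

Lemma lmonD k l : lmon (k + l) = lmon k * lmon l.
Proof. by apply: laurentP => n; rewrite lcoef_mon !lmonE; congr (nat_of_bool _)%:R; lia. Qed.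

Lemma lconst_bounded (c : R) : (fun n => c * (n == 0)%:R) \in bounded_below.
Proof. by apply: (@order_ge_laurent 0) => n hn; rewrite lt_eqF ?mulr0. Qed.

Definition lconst (c : R) : laurent := Laurent (lconst_bounded c).

Lemma lconstE c n : lconst c n = c * (n == 0)%:R. Proof. by []. Qed.

Lemma lcoef_const c f n : (lconst c * f) n = c * f n.
Proof.
rewrite lcoefM (@zsum_single _ 0) => [|i hi]; first by rewrite lconstE eqxx mulr1 subr0.
by rewrite lconstE (negPf hi) mulr0 mul0r.
Qed.

Lemma lconst_zmod_morphism : zmod_morphism lconst.
Proof. by move=> c d; apply: laurentP => n; rewrite lcoefB !lconstE mulrBl. Qed.
HB.instance Definition _ :=
  GRing.isZmodMorphism.Build R laurent lconst lconst_zmod_morphism.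

Lemma lconst_monoid_morphism : monoid_morphism lconst.
Proof.
split=> [|c d]; apply: laurentP => n; first by rewrite lconstE mul1r.
by rewrite lcoef_const !lconstE mulrA.
Qed.
HB.instance Definition _ :=
  GRing.isMonoidMorphism.Build R laurent lconst lconst_monoid_morphism.

Lemma order_geD f g A : order_ge A f -> order_ge A g -> order_ge A (f + g).
Proof. by move=> hf hg n hn; rewrite lcoefD hf ?hg ?addr0. Qed.

Lemma order_geN f A : order_ge A f -> order_ge A (- f).
Proof. by move=> hf n hn; rewrite lcoefN hf ?oppr0. Qed.

Lemma order_geM f g A B : order_ge A f -> order_ge B g -> order_ge (A + B) (f * g).
Proof. exact: order_ge_conv. Qed.

Lemma order_geW f (A B : int) : B <= A -> order_ge A f -> order_ge B f.
Proof. by move=> BA hf n hn; apply: hf; lia. Qed.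

Lemma order_ge_const c f A : order_ge A f -> order_ge A (lconst c * f).
Proof. by move=> hf n hn; rewrite lcoef_const hf ?mulr0. Qed.

Lemma order_ge_mon k : order_ge k (lmon k).
Proof. by move=> n hn; rewrite lmonE lt_eqF. Qed.

Lemma order_ge1 : order_ge 0 (1 : laurent).
Proof. exact: order_ge_mon. Qed.

Lemma order_ge_exp f A k : order_ge A f -> order_ge (k%:Z * A) (f ^+ k).
Proof.
move=> hf; elim: k => [|k IH]; first by rewrite expr0 mul0r; exact: order_ge1.
by rewrite exprS intS mulrDl mul1r; exact: order_geM.
Qed.

Lemma lead_coefM f g A B : order_ge A f -> order_ge B g -> (f * g) (A + B) = f A * g B.
Proof.
move=> hf hg; rewrite lcoefM (@zsum_single _ A) => [|i hi]; first by rewrite addrAC subrr add0r.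
have [hi'|hi'] := ltP i A; first by rewrite hf ?mul0r.
by rewrite hg ?mulr0 //; lia.
Qed.

Lemma lead_coef_exp f A k : order_ge A f -> (f ^+ k) (k%:Z * A) = f A ^+ k.
Proof.
move=> hf; elim: k => [|k IH]; first by rewrite expr0 mul0r lcoef1.
by rewrite !exprS intS mulrDl mul1r lead_coefM ?IH //; exact: order_ge_exp.
Qed.

Definition lpartial f (A : int) (K : nat) : laurent :=
  \sum_(i < K) lconst (f (A + i%:Z)) * lmon (A + i%:Z).

Lemma order_ge_lpartial f A K : order_ge A f -> order_ge (A + K%:Z) (f - lpartial f A K).
Proof.
move=> hf n hn; rewrite lcoefB lcoef_sum.
under eq_bigr => i _ do rewrite lcoef_const lmonE.
have [hnA|hnA] := ltP n A.
  by rewrite hf // big1 ?subr0 // => i _; rewrite (_ : (n == _) = false) ?mulr0 //; lia.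
have hK : (absz (n - A)%R < K)%N by lia.
rewrite (bigD1 (Ordinal hK)) //= big1 => [|i].
  by rewrite (_ : A + (absz (n - A)%R)%:Z = n) ?eqxx ?mulr1 ?addr0 ?subrr //; lia.
rewrite -val_eqE /= => hi; rewrite (_ : (n == _) = false) ?mulr0 //; lia.
Qed.

Section GeometricSeries.
Variable g : laurent.
Hypothesis hg : order_ge 1 g.

Lemma geometric_bounded :
  (fun n => if n is Posz m then (\sum_(k < m.+1) g ^+ k) n else 0) \in bounded_below.
Proof. by apply: (@order_ge_laurent 0); case. Qed.

Definition geometric : laurent := Laurent geometric_bounded.

Lemma geometricE (m : nat) : geometric m = (\sum_(k < m.+1) g ^+ k) m.
Proof. by []. Qed.

Lemma order_ge_geometric : order_ge 0 geometric.
Proof. by case. Qed.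

Lemma geometric_truncate (N : nat) : order_ge N%:Z (geometric - \sum_(k < N) g ^+ k).
Proof.
have g0 (k : nat) n : n < k%:Z -> (g ^+ k) n = 0.
  by move=> hn; rewrite (order_ge_exp hg) // mulr1.
case=> [m hm|m _]; last first.
  by rewrite lcoefB order_ge_geometric // lcoef_sum big1 ?subr0 // => k _; exact: g0.
have mN : (m < N)%N by [].
rewrite lcoefB geometricE !lcoef_sum.
rewrite (big_ord_widen _ (fun k => (g ^+ k) (Posz m)) mN) big_mkcond -sumrB big1 // => k _.
by case: ifP => hk; rewrite ?subrr // g0 ?subr0 //; lia.
Qed.

Lemma geometricK : (1 - g) * geometric = 1.
Proof.
apply: laurentP => n; pose N := (absz n).+1.
have -> : (1 - g) * geometric = 1 - g ^+ N + (1 - g) * (geometric - \sum_(k < N) g ^+ k).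
  by rewrite mulrBr -opprB -(opprB (g ^+ N)) subrX1; ring.
have h1g : order_ge 0 (1 - g).
  by apply: order_geD order_ge1 (order_geN (order_geW _ hg)).
rewrite lcoefD lcoefB (order_ge_exp hg) ?subr0; last by lia.
by rewrite (order_geM h1g (geometric_truncate (N := N))) ?addr0 //; lia.
Qed.

End GeometricSeries.

Lemma lderiv_bounded f : (fun n => (n + 1)%:~R * f (n + 1)) \in bounded_below.
Proof.
have [A hA] := laurent_order f; apply: (@order_ge_laurent (A - 1)) => n hn.
by rewrite hA ?mulr0 //; lia.
Qed.

Definition lderiv f : laurent := Laurent (lderiv_bounded f).

Lemma lderivE f n : lderiv f n = (n + 1)%:~R * f (n + 1). Proof. by []. Qed.

Lemma lderiv_zmod_morphism : zmod_morphism lderiv.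
Proof. by move=> f g; apply: laurentP => n; rewrite lcoefB !lderivE lcoefB mulrBr. Qed.
HB.instance Definition _ :=
  GRing.isZmodMorphism.Build laurent laurent lderiv lderiv_zmod_morphism.

Lemma lderiv_constM c f : lderiv (lconst c * f) = lconst c * lderiv f.
Proof. by apply: laurentP => n; rewrite lcoef_const !lderivE lcoef_const mulrCA. Qed.

Lemma lderiv_mon k : lderiv (lmon k) = lconst k%:~R * lmon (k - 1).
Proof.
apply: laurentP => n; rewrite lcoef_const lderivE !lmonE -(inj_eq (addIr (-1))) addrK.
by case: eqP => [->|]; rewrite ?mulr0 // subrK.
Qed.

Lemma lderivM f g : lderiv (f * g) = lderiv f * g + f * lderiv g.
Proof.
apply: laurentP => n; rewrite lderivE lcoefD !lcoefM.
rewrite -(zsum_morph (mulrDr (n + 1)%:~R)); last exact: (bounded_supp_conv f g).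
have -> : \zsum_i lderiv f i * g (n - i) = \zsum_i (i%:~R * (f i * g (n + 1 - i))).
  rewrite -[RHS](@zsum_shift _ 1); apply: eq_zsum => i; rewrite lderivE -!mulrA.
  by congr (_ * (_ * g _)); lia.
rewrite -zsumD; last exact: (bounded_supp_conv f (lderiv g)).
  apply: eq_zsum => i; rewrite lderivE (_ : n - i + 1 = n + 1 - i); last by lia.
  by rewrite [in RHS]rmorphB /=; ring.
have [l [u fg0]] := bounded_supp_conv f g (n + 1); exists l, u => i /fg0 ->.
by rewrite mulr0.
Qed.

Lemma order_ge_lderiv0 f : order_ge 0 f -> order_ge 0 (lderiv f).
Proof.
move=> hf n hn; rewrite lderivE; have [hn'|hn'] := ltP (n + 1) 0; first by rewrite hf ?mulr0.
by rewrite (_ : n + 1 = 0) ?mul0r //; lia.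
Qed.

Definition lderivn (m : nat) f := iter m lderiv f.

Lemma lderivnS m f : lderivn m.+1 f = lderiv (lderivn m f). Proof. by []. Qed.

Lemma lderivn_zmod_morphism m : zmod_morphism (lderivn m).
Proof. by move=> f g; elim: m => // m IH; rewrite !lderivnS IH raddfB. Qed.
HB.instance Definition _ m :=
  GRing.isZmodMorphism.Build laurent laurent (lderivn m) (lderivn_zmod_morphism m).

Lemma lderivn_constM m c f : lderivn m (lconst c * f) = lconst c * lderivn m f.
Proof. by elim: m => // m IH; rewrite !lderivnS IH lderiv_constM. Qed.

Lemma lderivn_mon m k :
  lderivn m (lmon k) = lconst (\prod_(j < m) (k%:~R - j%:R)) * lmon (k - m%:Z).
Proof.
elim: m => [|m IH]; first by rewrite big_ord0 rmorph1 mul1r subr0.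
rewrite lderivnS IH lderiv_constM lderiv_mon mulrA -rmorphM big_ord_recr /= rmorphB /=.
by congr (_ * lmon _); lia.
Qed.

Lemma order_ge_lderivn m f A : order_ge A f -> order_ge (A - m%:Z) (lderivn m f).
Proof.
move=> hf; elim: m => [|m IH] n hn; first by apply: hf; lia.
by rewrite lderivnS lderivE IH ?mulr0 //; lia.
Qed.

Lemma order_ge_lderivn0 m f : order_ge 0 f -> order_ge 0 (lderivn m f).
Proof. by move=> hf; elim: m => // m IH; exact: order_ge_lderiv0. Qed.

End LaurentSeries.

Arguments lcoef : simpl never.
Arguments lmon {R}.

Section Exponential.
Variable R : numFieldType.
Implicit Types (f g h : laurent R) (c d t : R) (p q : {poly R}).

Lemma natr_fact_neq0 m : (m`!)%:R != 0 :> R.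
Proof. by rewrite pnatr_eq0 -lt0n fact_gt0. Qed.

Lemma lexp_bounded c :
  (fun n => if n is Posz m then c ^+ m / m`!%:R else 0) \in @bounded_below R.
Proof. by apply: (@order_ge_laurent _ 0); case. Qed.

Definition lexp c : laurent R := Laurent (lexp_bounded c).

Lemma lexpE c (m : nat) : lexp c m = c ^+ m / m`!%:R. Proof. by []. Qed.

Lemma order_ge_lexp c : order_ge 0 (lexp c). Proof. by case. Qed.

Lemma order_ge_lexpM c f A : order_ge A f -> order_ge A (lexp c * f).
Proof. by move=> hf; rewrite -[A]add0r; apply: order_geM hf; exact: order_ge_lexp. Qed.

Lemma lexp_coef0 c : lexp c 0 = 1.
Proof. by rewrite lexpE expr0 fact0 divr1. Qed.

Lemma lexp_coef1 c : lexp c 1 = c.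
Proof. by rewrite lexpE expr1 (_ : 1`!%:R = 1 :> R) // divr1. Qed.

Lemma lexpD c d : lexp (c + d) = lexp c * lexp d.
Proof.
apply: laurentP => -[n|n]; last first.
  by rewrite (order_ge_lexpM c (order_ge_lexp d)).
rewrite lcoefM (@zsum_ord _ 0 n.+1) => [|i hi]; last first.
  have [hi'|hi'] := ltP i 0; first by rewrite order_ge_lexp ?mul0r.
  by rewrite [X in _ * X]order_ge_lexp ?mulr0 //; lia.
rewrite addrC lexpE exprDn mulr_suml; apply: eq_bigr => -[k kn] _ /=.
rewrite add0r (_ : n%:Z - k%:Z = (n - k)%N); last by lia.
rewrite !lexpE -(@bin_fact n k) // !natrM -mulr_natr.
have factnk := natr_fact_neq0 (n - k)%N; have factk := natr_fact_neq0 k.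
have bin_neq0 : ('C(n, k))%:R != 0 :> R by rewrite pnatr_eq0 -lt0n bin_gt0.
by field; rewrite factnk factk bin_neq0.
Qed.

Lemma lexp0 : lexp 0 = 1.
Proof.
apply: laurentP => -[[|n]|n] //; first by rewrite lexp_coef0.
by rewrite lexpE exprS mul0r mul0r.
Qed.

Lemma lexpK c f : lexp (- c) * (lexp c * f) = f.
Proof. by rewrite mulrA -lexpD addNr lexp0 mul1r. Qed.

Lemma lexp_natX n : lexp 1 ^+ n = lexp n%:R.
Proof. by elim: n => [|n IH]; rewrite ?lexp0 // exprS IH -lexpD nat1r. Qed.

Lemma lderiv_lexp c : lderiv (lexp c) = lconst c * lexp c.
Proof.
apply: laurentP => n; rewrite lderivE lcoef_const; case: n => [n|[|n]].
- rewrite (_ : n%:Z + 1 = n.+1); last by lia.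
  have n_neq0 : n.+1%:R != 0 :> R by rewrite pnatr_eq0.
  have factn := natr_fact_neq0 n.
  rewrite !lexpE factS natrM exprS -pmulrn.
  by move: (n.+1%:R : R) n_neq0 => x x_neq0; field; rewrite x_neq0 factn.
- by rewrite (_ : Negz 0 + 1 = 0) // mul0r order_ge_lexp ?mulr0.
- by rewrite !order_ge_lexp ?mulr0.
Qed.

Lemma lderiv_lexpM c f : lderiv (lexp c * f) = lexp c * (lconst c * f + lderiv f).
Proof. by rewrite lderivM lderiv_lexp; ring. Qed.

Definition lxi : laurent R := 1 - lexp (-1).

Lemma order_ge_lxi : order_ge 1 lxi.
Proof. by case=> [[|n]|n] // _; rewrite lcoefB lcoef1 ?lexp_coef0 ?order_ge_lexp ?subrr. Qed.

Lemma lead_coef_lxi : lxi 1 = 1.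
Proof. by rewrite lcoefB lexp_coef1 lcoef1 sub0r opprK. Qed.

Let lxi_unit_part : laurent R := 1 - lmon (-1) * lxi.

Let order_ge_lxi_unit_part : order_ge 1 lxi_unit_part.
Proof.
move=> n hn; rewrite lcoefB lcoef_mon lcoef1 opprK.
have [n0|n0] := eqVneq n 0; first by rewrite n0 lead_coef_lxi subrr.
by rewrite order_ge_lxi ?subrr //; lia.
Qed.

Definition lkappa : laurent R := lmon (-1) * geometric lxi_unit_part.

Lemma lkappaK : lkappa * lxi = 1.
Proof.
have xiE : lxi = lmon 1 * (1 - lxi_unit_part).
  by rewrite subKr mulrA -lmonD subrr mul1r.
rewrite /lkappa [in X in _ * X]xiE mulrACA -lmonD addNr mul1r mulrC.
exact: geometricK order_ge_lxi_unit_part.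
Qed.

Lemma order_ge_lkappa : order_ge (-1) lkappa.
Proof.
rewrite -[-1]addr0; apply: order_geM; first exact: order_ge_mon.
exact: order_ge_geometric.
Qed.

Lemma lead_coef_lkappa : lkappa (-1) = 1.
Proof.
by rewrite lcoef_mon subrr geometricE big_ord1.
Qed.

Lemma lxi_inj : injective ( *%R lxi).
Proof. by move=> f g /(congr1 ( *%R lkappa)); rewrite !mulrA lkappaK !mul1r. Qed.

Definition lkernel t : laurent R := lexp (- t) * lkappa.

Lemma order_ge_lkernel t : order_ge (-1) (lkernel t).
Proof. exact: order_ge_lexpM order_ge_lkappa. Qed.

Lemma lkernelB t : lkernel t - lkernel (t + 1) = lexp (- t).
Proof. by rewrite -[RHS]mulr1 -lkappaK /lkernel opprD lexpD /lxi; ring. Qed.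

(* [p(-d/dz) h(z)] *)
Definition pderiv h p : laurent R := foldr (fun c g => lconst c * h - lderiv g) 0 p.

Lemma pderiv0 h : pderiv h 0 = 0.
Proof. by rewrite /pderiv polyseq0. Qed.

Lemma pderiv_cons h p c : pderiv h (p * 'X + c%:P) = lconst c * h - lderiv (pderiv h p).
Proof.
rewrite -cons_poly_def /pderiv polyseq_cons; case: ifP => // /negbFE/nilP p0.
rewrite p0 /= raddf0 subr0 polyseqC.
by case: eqP => [->|_] /=; rewrite ?rmorph0 ?mul0r ?raddf0 ?addr0.
Qed.

Lemma pderivC h c : pderiv h c%:P = lconst c * h.
Proof. by rewrite -[c%:P]add0r -(mul0r 'X) pderiv_cons pderiv0 raddf0 subr0. Qed.

Lemma pderivMX h p : pderiv h (p * 'X) = - lderiv (pderiv h p).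
Proof. by rewrite -[p * 'X]addr0 -polyC0 pderiv_cons rmorph0 mul0r sub0r. Qed.

Lemma pderivD h p q : pderiv h (p + q) = pderiv h p + pderiv h q.
Proof.
elim/poly_ind: p q => [|p c IH] q; first by rewrite pderiv0 !add0r.
elim/poly_ind: q => [|q d _]; first by rewrite pderiv0 !addr0.
rewrite addrACA -mulrDl -polyCD !pderiv_cons IH !raddfD /=; ring.
Qed.

Lemma pderivZ h c p : pderiv h (c *: p) = lconst c * pderiv h p.
Proof.
elim/poly_ind: p => [|p d IH]; first by rewrite scaler0 pderiv0 mulr0.
rewrite scalerDr scalerAl scale_polyC !pderiv_cons IH lderiv_constM rmorphM /=; ring.
Qed.

Lemma pderivN h p : pderiv h (- p) = - pderiv h p.
Proof. by rewrite -scaleN1r pderivZ rmorphN rmorph1 mulN1r. Qed.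

Lemma pderivBl g h p : pderiv (g - h) p = pderiv g p - pderiv h p.
Proof.
elim/poly_ind: p => [|p c IH]; first by rewrite !pderiv0 subr0.
by rewrite !pderiv_cons IH raddfB /=; ring.
Qed.

Lemma pderiv_lexp c p : pderiv (lexp c) p = lconst p.[- c] * lexp c.
Proof.
elim/poly_ind: p => [|p d IH]; first by rewrite pderiv0 horner0 rmorph0 mul0r.
rewrite pderiv_cons IH lderiv_constM lderiv_lexp hornerMXaddC.
by rewrite rmorphD rmorphM rmorphN /=; ring.
Qed.

Lemma lexpM_pderiv c h p : lexp c * pderiv h p = pderiv (lexp c * h) (p \Po ('X + c%:P)).
Proof.
elim/poly_ind: p => [|p d IH]; first by rewrite comp_poly0 !pderiv0 mulr0.
rewrite comp_polyD comp_polyC comp_polyM comp_polyX mulrDr pderiv_cons !pderivD pderivMX.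
rewrite pderivC -IH mulrC [_ * c%:P]mulrC mul_polyC pderivZ -IH lderiv_lexpM.
by rewrite mulrDl; ring.
Qed.

Lemma pderiv_subX_exp h m c :
  pderiv h ((c%:P - 'X) ^+ m) = lexp (- c) * lderivn m (lexp c * h).
Proof.
elim: m => [|m IH]; first by rewrite expr0 pderivC rmorph1 mul1r lexpK.
rewrite exprSr mulrBr pderivD pderivN pderivMX mulrC mul_polyC pderivZ IH.
by rewrite lderivnS lderiv_lexpM rmorphN /=; ring.
Qed.

(* Multiplying by [1 - e^(-z)] turns the left side into
   [(p - p(x - 1))(-d/dz) (e^(-(s+t)z) kappa)], the boundary term vanishing at [s + t - 1]. *)
Lemma pderiv_lkernel_telescope m (s t : R) p :
  p - (p \Po ('X - 1%:P)) = (m`!%:R)^-1 *: (t%:P - 'X) ^+ m -> p.[s + t - 1] = 0 ->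
  pderiv (lkernel (s + t)) p =
  lconst (m`!%:R)^-1 * lderivn m (lkernel s) * lkernel t.
Proof.
move=> hp p0; apply: lxi_inj; rewrite {1}/lxi mulrBl mul1r lexpM_pderiv polyCN.
have -> : lexp (-1) * lkernel (s + t) = lkernel (s + t) - lexp (- (s + t)).
  by rewrite -(lkernelB (s + t)) subKr /lkernel mulrA -lexpD -opprD (addrC 1).
rewrite pderivBl pderiv_lexp.
have -> : (p \Po ('X - 1%:P)).[- - (s + t)] = 0.
  by rewrite horner_comp hornerXsubC opprK p0.
rewrite rmorph0 mul0r subr0 -pderivN -pderivD hp pderivZ pderiv_subX_exp.
have -> : lexp t * lkernel (s + t) = lkernel s.
  by rewrite mulrA -lexpD opprD addrCA subrr addr0.
by rewrite -[LHS]mulr1 -lkappaK /lkernel; ring.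
Qed.

Section AntiDifference.

Let rising (n : nat) : {poly R} := \prod_(j < n) ('X + j%:R%:P).

Let rising_diff n : rising n.+1 - (rising n.+1 \Po ('X - 1%:P)) = n.+1%:R *: rising n.
Proof.
have -> : rising n.+1 \Po ('X - 1%:P) = ('X - 1%:P) * rising n.
  rewrite /rising rmorph_prod big_ord_recl /= !rmorphD /= comp_polyX !comp_polyC addr0.
  congr (_ * _); apply: eq_bigr => j _; rewrite rmorphD /= comp_polyX comp_polyC.
  by rewrite /bump /= add1n -natr1 polyCD; ring.
by rewrite /rising big_ord_recr /= -mul_polyC -natr1 polyCD; ring.
Qed.

Lemma poly_antidifference q : exists p, p - (p \Po ('X - 1%:P)) = q.
Proof.
suff [p hp] : exists p, p - (p \Po ('X - 1%:P)) = q * rising 0.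
  by exists p; rewrite hp /rising big_ord0 mulr1.
elim/poly_ind: q 0%N => [|q c IH] n; first by exists 0; rewrite comp_poly0 subr0 mul0r.
have [p pE] := IH n.+1; have [r rE] := IH n.
exists (p - n%:R *: r + (c / n.+1%:R) *: rising n.+1).
rewrite !(comp_polyD, comp_polyB, comp_polyZ).
transitivity ((p - (p \Po ('X - 1%:P))) - n%:R *: (r - (r \Po ('X - 1%:P)))
   + (c / n.+1%:R) *: (rising n.+1 - (rising n.+1 \Po ('X - 1%:P)))).
  by rewrite -!mul_polyC; ring.
rewrite pE rE rising_diff scalerA divfK ?pnatr_eq0 // /rising big_ord_recr /=.
by rewrite -!mul_polyC; ring.
Qed.

Lemma poly_antidifference_root q c : exists p, p - (p \Po ('X - 1%:P)) = q /\ p.[c] = 0.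
Proof.
have [p hp] := poly_antidifference q; exists (p - p.[c]%:P); split.
  by rewrite comp_polyB comp_polyC -hp; ring.
by rewrite hornerD hornerN hornerC subrr.
Qed.

End AntiDifference.

End Exponential.

Arguments lxi {R}.
Arguments lkappa {R}.

(** * Polynomial sequences *)

Section FiniteDifferences.
Variable M : zmodType.
Implicit Types u v : int -> M.

Definition diff u (t : int) : M := u t - u (t + 1).

Lemma diffE u t : diff u t = u t - u (t + 1). Proof. by []. Qed.

Definition degree_lt (K : nat) u : Prop := forall t, iter K diff u t = 0.

Lemma degree_lt_eq0 K u : (forall t, u t = 0) -> degree_lt K u.
Proof.
elim: K u => // K IH u u0 t; rewrite iterSr; apply: IH => s.
by rewrite diffE !u0 subrr.
Qed.

Lemma degree_ltS K u : degree_lt K.+1 u <-> degree_lt K (diff u).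
Proof. by split=> hu t; have := hu t; rewrite iterSr. Qed.

Lemma degree_lt_iter K n u : degree_lt K u -> degree_lt K (iter n diff u).
Proof.
move=> uK t; rewrite -iterD addnC iterD (_ : iter K diff u = fun=> 0); last exact: funext.
exact: (degree_lt_eq0 n (u := fun=> 0)).
Qed.

Lemma degree_ltW K L u : (K <= L)%N -> degree_lt K u -> degree_lt L u.
Proof.
elim: K L u => [|K IH] L u; first by move=> _ /(degree_lt_eq0 L).
by case: L => // L KL /degree_ltS hu; apply/degree_ltS; exact: IH.
Qed.

Lemma iter_diffB n u v :
  iter n diff (fun t => u t - v t) = fun t => iter n diff u t - iter n diff v t.
Proof.
elim: n => // n IH; apply: funext => t.
by rewrite !iterS IH !diffE !opprD !opprK addrACA.
Qed.

Lemma degree_ltB K u v : degree_lt K u -> degree_lt K v -> degree_lt K (fun t => u t - v t).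
Proof. by move=> hu hv t; rewrite iter_diffB hu hv subrr. Qed.

Lemma degree_ltN K u : degree_lt K u -> degree_lt K (fun t => - u t).
Proof.
move=> hu; have := degree_ltB (degree_lt_eq0 K (fun=> erefl (0 : M))) hu.
by under eq_fun do rewrite sub0r.
Qed.

Lemma degree_ltD K u v : degree_lt K u -> degree_lt K v -> degree_lt K (fun t => u t + v t).
Proof. by move=> hu /degree_ltN hv; under eq_fun do rewrite -[v _]opprK; exact: degree_ltB. Qed.

Lemma degree_lt_shift K k u : degree_lt K u -> degree_lt K (fun t => u (t + k)).
Proof.
elim: K u => [|K IH] u hu; first by move=> t; exact: hu.
apply/degree_ltS; suff -> : diff (fun t => u (t + k)) = fun t => diff u (t + k).
  exact/IH/degree_ltS.
by apply: funext => t; rewrite !diffE addrAC.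
Qed.

Lemma degree_lt_rev K k u : degree_lt K u -> degree_lt K (fun t => u (k - t)).
Proof.
elim: K k u => [|K IH] k u hu; first by move=> t; exact: hu.
apply/degree_ltS; suff -> : diff (fun t => u (k - t)) = fun t => - diff u ((k - 1) - t).
  exact/degree_ltN/IH/degree_ltS.
apply: funext => t; rewrite !diffE opprB; congr (u _ - u _); lia.
Qed.

Lemma diff_eq0_const u : diff u = (fun=> 0) -> u = fun=> u 0.
Proof.
move=> u0; have uS t : u (t + 1) = u t.
  by apply/esym/eqP; rewrite -subr_eq0 -diffE u0.
have up (n : nat) t : u (t + n%:Z) = u t.
  elim: n => [|n IH]; first by rewrite addr0.
  by rewrite -IH -[RHS]uS; congr u; lia.
apply: funext => t; rewrite -(up (absz t) t) -(up (absz (t + (absz t)%:Z)%R) 0).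
by congr u; lia.
Qed.

Lemma degree_lt_order_ge_eq0 K u A : degree_lt K u -> order_ge A u -> u = fun=> 0.
Proof.
elim: K u A => [|K IH] u A; first by move=> hu _; exact: funext.
move=> /degree_ltS hu uA; have d0 : diff u = fun=> 0.
  by apply: IH (A - 1) hu _ => t ht; rewrite diffE !uA ?subrr //; lia.
have ucst := diff_eq0_const d0; rewrite ucst.
have -> // : u 0 = 0.
by rewrite -[LHS](congr1 (@^~ (A - 1)) ucst) uA //; lia.
Qed.

End FiniteDifferences.

Lemma iter_diff_morph (M N : zmodType) (g : M -> N) n (u : int -> M) :
  {morph g : x y / x - y} -> iter n (@diff N) (g \o u) = g \o iter n (@diff M) u.
Proof. by move=> gB; elim: n => //= n ->; apply: funext => t; rewrite /= !diffE gB. Qed.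

Lemma degree_lt_morph (M N : zmodType) (g : M -> N) K (u : int -> M) :
  {morph g : x y / x - y} -> degree_lt K u -> degree_lt K (g \o u).
Proof.
by move=> gB hu t; rewrite iter_diff_morph //= hu -(subrr (g 0)) -gB subrr.
Qed.

Section TwoVariables.
Variable M : zmodType.
Implicit Types F G : int -> int -> M.

Lemma degree_lt_diagonal K L F :
  (forall t, degree_lt K (F t)) -> (forall p, degree_lt L (F^~ p)) ->
  degree_lt (K + L) (fun t => F t t).
Proof.
have [N] := ubnP (K + L); elim: N K L F => // N IH [|K] L F hN hK hL.
  by apply: degree_lt_eq0 => t; exact: hK.
case: L hN hL => [|L] hN hL; first by apply: degree_lt_eq0 => t; exact: hL.
rewrite addSn; apply/degree_ltS.
have -> : diff (fun t => F t t) = fun t =>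
    diff (F^~ t) t + diff (F (t + 1)) t.
  by apply: funext => t; rewrite !diffE subrKA.
apply: degree_ltD.
  rewrite -addSnnS.
  apply: (IH _ _ (fun t p => diff (F^~ p) t)) => [|t|p]; first by lia.
  - by apply: degree_ltB (hK t) (hK (t + 1)).
  - exact/degree_ltS.
apply: (IH _ _ (fun t => diff (F (t + 1)))) => [|t|p]; first by lia.
- exact/degree_ltS.
- by apply: degree_ltB; [exact: (degree_lt_shift 1 (hL p))|exact: (degree_lt_shift 1 (hL (p + 1)))].
Qed.

(* Dong's lemma for sequences: the difference operator in [p] is the sum of the one in [q]
   and the antidiagonal one, and the latter two lower the degrees assumed. *)
Lemma degree_lt_dong K L N F G :
  (forall p, degree_lt K (F p)) -> (forall q, degree_lt L (G^~ q)) ->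
  (forall e : int, degree_lt N (fun p => F p (e - p) - G p (e - p))) ->
  forall q, degree_lt (K + N + L) (F^~ q).
Proof.
have [s] := ubnP (K + N); elim: s K N F G => // s IH [|K] N F G hs hF hG hFG q.
  by apply: degree_lt_eq0 => p; exact: hF.
case: N hs hFG => [|N] hs hFG.
  rewrite (_ : F = G); first exact: degree_ltW (leq_addl _ _) (hG q).
  apply: funext => p; apply: funext => r; apply/eqP; rewrite -subr_eq0.
  by have /eqP := hFG (p + r) p; rewrite /= (_ : p + r - p = r) //; lia.
rewrite addSn; apply/degree_ltS.
pose antidiff (H : int -> int -> M) (p r : int) := H p (r + 1) - H (p + 1) r.
have -> : diff (F^~ q) = fun p => diff (F p) q + antidiff F p q.
  by apply: funext => p; rewrite !diffE subrKA.
apply: degree_ltD.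
  apply: (IH _ _ (fun p => diff (F p)) (fun p => diff (G p))) => [|p|r|e]; first by lia.
  - exact/degree_ltS.
  - exact: degree_ltB (hG r) (hG (r + 1)).
  have := degree_ltB (hFG e) (hFG (e + 1)).
  congr degree_lt; apply: funext => p.
  rewrite (_ : e + 1 - p = e - p + 1); last by lia.
  by rewrite !diffE !opprD !opprK addrACA.
rewrite -addSnnS; apply: (IH K.+1 N (antidiff F) (antidiff G) _ _ _ _ q) => [|p|r|e]; first by lia.
- by apply: degree_ltB (hF (p + 1)); exact: (degree_lt_shift 1 (hF p)).
- by apply: degree_ltB (hG (r + 1)) _; exact: (degree_lt_shift 1 (hG r)).
move/degree_ltS: (hFG (e + 1)); congr degree_lt; apply: funext => p.
rewrite diffE /antidiff (_ : e + 1 - p = e - p + 1); last by lia.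
rewrite (_ : e + 1 - (p + 1) = e - p); last by lia.
by rewrite !opprD !opprK addrACA.
Qed.

End TwoVariables.

Lemma degree_lt_mulz (R : pzRingType) (M : lmodType R) K (u : int -> M) :
  degree_lt K u -> degree_lt K.+1 (fun t => t%:~R *: u t).
Proof.
elim: K u => [|K IH] u uK; first by apply: degree_lt_eq0 => t; rewrite [u t]uK scaler0.
apply/degree_ltS.
have -> : diff (fun t => t%:~R *: u t) = fun t => t%:~R *: diff u t - u (t + 1).
  by apply: funext => t; rewrite !diffE rmorphD /= scalerDl scale1r opprD addrA -scalerBr.
apply: degree_ltB (degree_lt_shift 1 uK); apply: IH; exact/degree_ltS.
Qed.

(** * Residues and modes *)

Definition submodule_pred (R : pzRingType) (U : lmodType R) (P : U -> Prop) : Prop :=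
  P 0 /\ forall k x y, P x -> P y -> P (k *: x + y).

Section SubmodulePredicates.
Variables (R : pzRingType) (U : lmodType R) (P : U -> Prop) (hP : submodule_pred P).

Lemma submodule_predZ k x : P x -> P (k *: x).
Proof. by move=> Px; rewrite -[k *: x]addr0; apply: hP.2 => //; exact: hP.1. Qed.

Lemma submodule_predD x y : P x -> P y -> P (x + y).
Proof. by move=> Px Py; rewrite -[x]scale1r; exact: hP.2. Qed.

Lemma submodule_predB x y : P x -> P y -> P (x - y).
Proof. by move=> Px Py; rewrite addrC -scaleN1r; exact: hP.2. Qed.

Lemma submodule_pred_zsum (f : int -> U) : (forall i, P (f i)) -> P (zsum f).
Proof.
move=> Pf; apply: big_ind => //; [exact: hP.1|exact: submodule_predD].
Qed.

End SubmodulePredicates.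

Definition upper_trunc (M : zmodType) (K : int) (m : int -> M) : Prop :=
  forall n, K <= n -> m n = 0.

Section Residues.
Variables (R : comNzRingType) (M : lmodType R).
Implicit Types (f g h : laurent R) (m : int -> M) (K : int).

(* [Res_z h(z) \sum_n m_n z^(-n-1)] *)
Definition residue h m : M := \zsum_n (h n *: m n).

Lemma bounded_supp_residue h m K : upper_trunc K m -> bounded_supp (fun n => h n *: m n).
Proof.
move=> mK; have [A hA] := laurent_order h; exists A, K => n /orP[/hA ->|/mK ->].
  by rewrite scale0r.
by rewrite scaler0.
Qed.

Lemma residue_linearl K m (mK : upper_trunc K m) k g h :
  residue (lconst k * g + h) m = k *: residue g m + residue h m.
Proof.
have sf f := bounded_supp_residue f mK.
rewrite /residue -zsumZ // -zsumD //; last exact: bounded_suppZ.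
by apply: eq_zsum => n; rewrite lcoefD lcoef_const scalerDl scalerA.
Qed.

Lemma residueDl K m g h : upper_trunc K m -> residue (g + h) m = residue g m + residue h m.
Proof. by move=> mK; have := residue_linearl mK 1 g h; rewrite rmorph1 mul1r scale1r. Qed.

Lemma residue0l m : residue 0 m = 0.
Proof. by apply: zsum0 => n; rewrite scale0r. Qed.

Lemma residueZl K m k h : upper_trunc K m -> residue (lconst k * h) m = k *: residue h m.
Proof. by move=> mK; rewrite -[_ * h]addr0 (residue_linearl mK) residue0l addr0. Qed.

Lemma residueBl K m g h : upper_trunc K m -> residue (g - h) m = residue g m - residue h m.
Proof.
move=> mK; have := residue_linearl mK (-1) h g.
by rewrite rmorphN rmorph1 mulN1r scaleN1r ![- _ + _]addrC.
Qed.

Lemma residue_suml K m (I : Type) (r : seq I) (F : I -> laurent R) : upper_trunc K m ->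
  residue (\sum_(i <- r) F i) m = \sum_(i <- r) residue (F i) m.
Proof.
by move=> mK; apply: (big_morph (residue^~ m) (fun g h => residueDl g h mK) (residue0l m)).
Qed.

Lemma residue_mon m n : residue (lmon n) m = m n.
Proof.
rewrite /residue (@zsum_single _ n) => [|i hi]; first by rewrite lmonE eqxx scale1r.
by rewrite lmonE (negPf hi) scale0r.
Qed.

Lemma residue_order_ge K h m : upper_trunc K m -> order_ge K h -> residue h m = 0.
Proof.
move=> mK hh; apply: zsum0 => n; have [hn|hn] := ltP n K; first by rewrite hh ?scale0r.
by rewrite mK ?scaler0.
Qed.

Lemma eq_residue A h m m' : order_ge A h -> (forall n, A <= n -> m n = m' n) ->
  residue h m = residue h m'.
Proof.
move=> hA mm'; apply: eq_zsum => n; have [hn|hn] := ltP n A; last by rewrite mm'.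
by rewrite hA // !scale0r.
Qed.

(* A triangular system of vanishing residues, solved from the top mode down. *)
Lemma residue_triangular_eq0 K A m : upper_trunc K m ->
  (forall n, A <= n -> exists h, [/\ order_ge n h, h n = 1 & residue h m = 0]) ->
  forall n, A <= n -> m n = 0.
Proof.
move=> mK triangular; suff top (N : nat) n : A <= n -> K - N%:Z <= n -> m n = 0.
  by move=> n hn; apply: (top (absz (K - n)%R)) => //; lia.
elim: N n => [|N IH] n An hn; first by apply: mK; lia.
have [h [hh lead]] := triangular n An.
rewrite /residue (@zsum_single _ n) ?lead ?scale1r // => i ni.
have [hi|hi] := ltP i n; first by rewrite hh ?scale0r.
by rewrite IH ?scaler0 //; lia.
Qed.

Lemma residue_lderiv h m : residue (lderiv h) m = residue h (fun n => n%:~R *: m (n - 1)).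
Proof.
rewrite /residue -[RHS](@zsum_shift _ 1); apply: eq_zsum => n.
by rewrite addrK scalerA lderivE mulrC.
Qed.

Lemma residue_linearr K h m m' k : upper_trunc K m -> upper_trunc K m' ->
  residue h (fun n => k *: m n + m' n) = k *: residue h m + residue h m'.
Proof.
move=> mK mK'; have sm := bounded_supp_residue h mK.
have sm' := bounded_supp_residue h mK'.
rewrite /residue -zsumZ // -zsumD //; last exact: bounded_suppZ.
by apply: eq_zsum => n; rewrite scalerDr !scalerA mulrC.
Qed.

End Residues.

Lemma residue_morph (R : comNzRingType) (M N : lmodType R) (g : {linear M -> N}) K h
    (m : int -> M) :
  upper_trunc K m -> residue h (fun n => g (m n)) = g (residue h m).
Proof.
move=> mK; rewrite /residue -(@zsum_morph _ _ g) //; last exact: bounded_supp_residue mK.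
  by apply: eq_zsum => n; rewrite linearZ.
exact: linearD.
Qed.

Section LaurentFunctionals.
Variables (R : comNzRingType) (M : lmodType R).
Implicit Types (Phi : laurent R -> M) (K : int).

(* Continuity refers to the [z]-adic topology. *)
Definition continuous_functional Phi : Prop :=
  (forall k g h, Phi (lconst k * g + h) = k *: Phi g + Phi h) /\
  exists K, forall h : laurent R, order_ge K h -> Phi h = 0.

Lemma continuous_functional_residue K (m : int -> M) : upper_trunc K m ->
  continuous_functional (fun h => residue h m).
Proof.
move=> mK; split=> [k g h|]; first exact: residue_linearl mK k g h.
by exists K => h; exact: residue_order_ge.
Qed.

Lemma functional_residue Phi h : continuous_functional Phi ->
  (exists K, upper_trunc K (fun n => Phi (lmon n))) /\
  Phi h = residue h (fun n => Phi (lmon n)).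
Proof.
move=> [PhiL [K PhiK]].
have mK : upper_trunc K (fun n => Phi (lmon n)).
  by move=> n hn; apply: PhiK; apply: order_geW hn _; exact: order_ge_mon.
split; first by exists K.
have Phi0 : Phi 0 = 0 by exact: PhiK.
have PhiD g g' : Phi (g + g') = Phi g + Phi g'.
  by have := PhiL 1 g g'; rewrite rmorph1 mul1r scale1r.
have PhiZ k g : Phi (lconst k * g) = k *: Phi g.
  by have := PhiL k g 0; rewrite !addr0 Phi0 addr0.
have [A hA] := laurent_order h; pose N := absz (K - A)%R.
have oN : order_ge K (h - lpartial h A N).
  by apply: order_geW (order_ge_lpartial (K := N) hA); lia.
have -> : h = lpartial h A N + (h - lpartial h A N) by rewrite addrC subrK.
rewrite PhiD (PhiK _ oN) (residueDl _ _ mK) (residue_order_ge mK oN).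
rewrite (big_morph Phi PhiD Phi0) (residue_suml _ _ mK); congr (_ + _).
by apply: eq_bigr => i _; rewrite PhiZ (residueZl _ _ mK) residue_mon.
Qed.

Lemma continuous_functionalB Phi Psi : continuous_functional Phi ->
  continuous_functional Psi -> continuous_functional (fun h => Phi h - Psi h).
Proof.
move=> [PhiL [K PhiK]] [PsiL [L PsiL0]]; split=> [k g h|].
  by rewrite PhiL PsiL scalerBr opprD addrACA.
exists (Num.max K L) => h hh; rewrite PhiK ?PsiL0 ?subrr //; apply: order_geW hh; lia.
Qed.

Lemma continuous_functional_sum (n : nat) (F : nat -> laurent R -> M) :
  (forall i, continuous_functional (F i)) ->
  continuous_functional (fun h => \sum_(i < n) F i h).
Proof.
move=> Fc; elim: n => [|n [IHL [K IHK]]].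
  by split=> [k g h|]; [rewrite !big_ord0 scaler0 addr0|exists 0 => h _; rewrite big_ord0].
have [FnL [L FnK]] := Fc n; split=> [k g h|].
  by rewrite !big_ord_recr IHL FnL /= scalerDr addrACA.
exists (Num.max K L) => h hh.
by rewrite big_ord_recr /= IHK ?FnK ?addr0 //; apply: order_geW hh; lia.
Qed.

Lemma continuous_functional_comp Phi (L : laurent R -> laurent R) :
  continuous_functional Phi ->
  (forall k g h, L (lconst k * g + h) = lconst k * L g + L h) ->
  (exists A, forall (h : laurent R) K, order_ge K h -> order_ge (K + A) (L h)) ->
  continuous_functional (fun h => Phi (L h)).
Proof.
move=> [PhiL [K PhiK]] LL [A LA]; split=> [k g h|]; first by rewrite LL PhiL.
by exists (K - A) => h /LA; rewrite subrK; exact: PhiK.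
Qed.

End LaurentFunctionals.

Section Modes.
Variables (R : numFieldType) (M : lmodType R).
Implicit Types (h : laurent R) (m u v : int -> M) (t A : int).

Lemma order_ge_lexpM_lxiX c h A n :
  order_ge A h -> order_ge (A + n%:Z) (lexp c * (lxi ^+ n * h)).
Proof.
move=> hA; apply: order_ge_lexpM; rewrite addrC -[n%:Z]mulr1.
exact: order_geM (order_ge_exp (order_ge_lxi R)) hA.
Qed.

Lemma lead_coef_lexpM_lxiX c h A n :
  order_ge A h -> (lexp c * (lxi ^+ n * h)) (A + n%:Z) = h A.
Proof.
move=> hA; have hx := order_ge_exp (k := n) (order_ge_lxi R).
rewrite (_ : A + n%:Z = 0 + (n%:Z * 1 + A)); last by rewrite mulr1 add0r addrC.
rewrite (lead_coefM (@order_ge_lexp R c) (order_geM hx hA)) (lead_coefM hx hA).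
by rewrite (lead_coef_exp n (order_ge_lxi R)) lexp_coef0 lead_coef_lxi expr1n !mul1r.
Qed.

Lemma diff_residue K h m : upper_trunc K m ->
  diff (fun t => residue (lexp (- t%:~R) * h) m) =
  fun t => residue (lexp (- t%:~R) * (lxi * h)) m.
Proof.
move=> mK; apply: funext => t; rewrite diffE -(residueBl _ _ mK); congr residue.
by rewrite rmorphD opprD lexpD /lxi /=; ring.
Qed.

Lemma iter_diff_residue K n h m : upper_trunc K m ->
  iter n (@diff M) (fun t => residue (lexp (- t%:~R) * h) m) =
  fun t => residue (lexp (- t%:~R) * (lxi ^+ n * h)) m.
Proof.
move=> mK; elim: n => [|n IH]; first by rewrite expr0 mul1r.
by rewrite iterS IH (diff_residue _ mK) exprS -mulrA.
Qed.

Lemma degree_lt_residue K A n h m : upper_trunc K m -> order_ge A h -> K <= A + n%:Z ->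
  degree_lt n (fun t => residue (lexp (- t%:~R) * h) m).
Proof.
move=> mK hA hK t; rewrite (iter_diff_residue _ _ mK).
apply: (residue_order_ge mK); apply: order_geW hK _.
exact: order_ge_lexpM_lxiX.
Qed.

Lemma residue_lexp_inj K A h m : upper_trunc K m -> order_ge A h -> h A = 1 ->
  (forall t, residue (lexp (- t%:~R) * h) m = 0) -> forall n, A <= n -> m n = 0.
Proof.
move=> mK hA lead res0; apply: (residue_triangular_eq0 mK) => n An.
pose p := absz (n - A)%R; have np : n = A + p%:Z by lia.
exists (lexp (- 0%:~R) * (lxi ^+ p * h)); rewrite np; split.
- exact: order_ge_lexpM_lxiX.
- by rewrite lead_coef_lexpM_lxiX.
have <- := congr1 (@^~ 0) (iter_diff_residue p h mK); rewrite (funext res0).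
exact: (@degree_lt_eq0 _ p (fun=> 0)).
Qed.

Lemma functional_lkernel_eq0 (Phi : laurent R -> M) h : continuous_functional Phi ->
  (forall t : int, Phi (lkernel t%:~R) = 0) -> order_ge (-1) h -> Phi h = 0.
Proof.
move=> PhiC Phi0 hh; have [[K mK] ->] := functional_residue h PhiC.
suff Phi_mon n : -1 <= n -> Phi (lmon n) = 0.
  apply: zsum0 => n; have [hn|hn] := ltP n (-1); first by rewrite hh ?scale0r.
  by rewrite Phi_mon ?scaler0.
apply: (residue_lexp_inj mK (@order_ge_lkappa R) (@lead_coef_lkappa R)) => t.
by have := Phi0 t; rewrite (functional_residue _ PhiC).2.
Qed.

Definition mode_expansion m u : Prop :=
  [/\ order_ge (-1) m, exists K, upper_trunc K m &
      forall t, u t = residue (lkernel t%:~R) m].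

Lemma mode_expansion_linear k m m' u v : mode_expansion m u -> mode_expansion m' v ->
  mode_expansion (fun n => k *: m n + m' n) (fun t => k *: u t + v t).
Proof.
move=> [m_ge [K mK] um] [m'_ge [K' mK'] um']; pose L := Num.max K K'.
have mL : upper_trunc L m by move=> i hi; apply: mK; lia.
have mL' : upper_trunc L m' by move=> i hi; apply: mK'; lia.
split=> [n hn||t]; first by rewrite m_ge ?m'_ge ?scaler0 ?addr0.
  by exists L => n hn; rewrite mL ?mL' ?scaler0 ?addr0.
by rewrite um um' (residue_linearr _ _ mL mL').
Qed.

Lemma mode_expansion_eq0 m : mode_expansion m (fun=> 0) -> m = fun=> 0.
Proof.
move=> [m_ge [K mK] um]; apply: funext => n.
have [hn|hn] := ltP n (-1); first exact: m_ge.
apply: (residue_lexp_inj mK (@order_ge_lkappa R) (@lead_coef_lkappa R)) hn => t.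
exact/esym/um.
Qed.

Lemma mode_expansion_uniq m m' u : mode_expansion m u -> mode_expansion m' u -> m = m'.
Proof.
move=> um um'; have := mode_expansion_linear (-1) um' um.
have -> : (fun t => -1 *: u t + u t) = fun=> 0 by apply: funext => t; rewrite scaleN1r addNr.
move=> /mode_expansion_eq0 d0; apply: funext => n; apply/eqP; rewrite -subr_eq0.
by rewrite -scaleN1r addrC (congr1 (@^~ n) d0).
Qed.

Definition delta_mode (k : int) (x : M) (n : int) : M := if n == k then x else 0.

Lemma residue_delta_mode h k x : residue h (delta_mode k x) = h k *: x.
Proof.
rewrite /residue (@zsum_single _ k) => [|n nk]; first by rewrite /delta_mode eqxx.
by rewrite /delta_mode (negPf nk) scaler0.
Qed.

Lemma mode_expansion_delta k x : -1 <= k ->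
  mode_expansion (delta_mode k x) (fun t => (lkernel t%:~R : laurent R) k *: x).
Proof.
move=> hk; split=> [n hn||t]; last by rewrite residue_delta_mode.
  by rewrite /delta_mode ifF //; lia.
by exists (k + 1) => n hn; rewrite /delta_mode ifF //; lia.
Qed.

Lemma iter_diff_lkernel K x t :
  iter K (@diff M) (fun s => (lkernel s%:~R : laurent R) (K%:Z - 1) *: x) t = x.
Proof.
under eq_fun do rewrite -residue_delta_mode.
have dK : upper_trunc K%:Z (delta_mode (K%:Z - 1) x).
  by move=> n hn; rewrite /delta_mode ifF //; lia.
rewrite (iter_diff_residue _ _ dK) residue_delta_mode (addrC _ (-1)).
by rewrite (lead_coef_lexpM_lxiX _ _ (@order_ge_lkappa R)) lead_coef_lkappa scale1r.
Qed.

(* [iter K diff u] is a constant [x]; subtracting the sequence with the single mode [x] in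
   degree [K - 1], which has the same top difference, lowers the degree. *)
Lemma mode_expansion_exists (P : M -> Prop) K u : submodule_pred P ->
  degree_lt K u -> (forall t, P (u t)) ->
  exists m, [/\ mode_expansion m u, upper_trunc (K%:Z - 1) m & forall n, P (m n)].
Proof.
move=> hP; elim: K u => [|K IH] u uK Pu.
  exists (fun=> 0); split=> //; last by move=> n; exact: hP.1.
  by split=> // [|t]; [exists 0|rewrite [LHS]uK /residue zsum0 // => n; rewrite scaler0].
have Piter n t : P (iter n (@diff M) u t).
  by elim: n t => // n IHn t; rewrite iterS; exact: (submodule_predB hP).
have top_const t : iter K (@diff M) u t = iter K (@diff M) u 0.
  by rewrite (@diff_eq0_const _ (iter K (@diff M) u) (funext uK)).
pose x := iter K (@diff M) u 0; pose top t := (lkernel t%:~R : laurent R) (K%:Z - 1) *: x.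
have [t|t|m [um mK Pm]] := IH (fun t => u t - top t).
- by rewrite iter_diffB iter_diff_lkernel top_const subrr.
- exact: (submodule_predB hP (Pu t) (submodule_predZ hP _ (Piter K 0))).
exists (fun n => 1 *: delta_mode (K%:Z - 1) x n + m n); split.
- have xtop : mode_expansion (delta_mode (K%:Z - 1) x) top by apply: mode_expansion_delta; lia.
  rewrite (_ : u = fun t => 1 *: top t + (u t - top t)); first exact: mode_expansion_linear.
  by apply: funext => t; rewrite scale1r addrC subrK.
- by move=> n hn; rewrite mK ?addr0 ?scale1r /delta_mode ?ifF //; lia.
move=> n; apply: (submodule_predD hP) => //; apply: (submodule_predZ hP).
by rewrite /delta_mode; case: ifP => _; [exact: Piter|exact: hP.1].
Qed.

Definition modes u : int -> M := xget (fun=> 0) [set m | mode_expansion m u]%classic.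

Lemma modes_eq m u : mode_expansion m u -> modes u = m.
Proof.
move=> um; apply: (mode_expansion_uniq _ um).
exact: (@xgetPex _ (fun=> 0) [set m' | mode_expansion m' u]%classic (ex_intro _ m um)).
Qed.

Lemma modes_pred (P : M -> Prop) K u : submodule_pred P -> degree_lt K u ->
  (forall t, P (u t)) -> forall n, P (modes u n).
Proof.
by move=> hP uK Pu; have [m [/modes_eq -> _ Pm]] := mode_expansion_exists hP uK Pu.
Qed.

Lemma modesP K u : degree_lt K u ->
  mode_expansion (modes u) u /\ upper_trunc (K%:Z - 1) (modes u).
Proof.
move=> uK; have PT : submodule_pred (fun _ : M => True) by [].
by have [m [um mK _]] := mode_expansion_exists PT uK (fun=> I); rewrite (modes_eq um).
Qed.

Lemma modes_linear K L k u v : degree_lt K u -> degree_lt L v ->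
  modes (fun t => k *: u t + v t) = fun n => k *: modes u n + modes v n.
Proof.
move=> /modesP[um _] /modesP[vm _].
by apply: modes_eq; exact: mode_expansion_linear.
Qed.

Lemma modes_cst x : modes (fun=> x) = delta_mode (-1) x.
Proof.
apply: modes_eq; have := mode_expansion_delta x (lexx (-1)).
congr mode_expansion; apply: funext => t.
by rewrite -[-1]add0r lead_coefM ?lexp_coef0 ?lead_coef_lkappa ?mulr1 ?scale1r //;
  [exact: order_ge_lexp|exact: order_ge_lkappa].
Qed.

End Modes.

Lemma modes_morph (R : numFieldType) (M N : lmodType R) (g : {linear M -> N}) K (u : int -> M) :
  degree_lt K u -> modes (g \o u) = g \o modes u.
Proof.
move=> uK; have [[m_ge [L mL] um] _] := modesP uK.
apply: modes_eq; split=> [n hn||t]; first by rewrite /= m_ge ?linear0.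
  by exists L => n hn; rewrite /= mL ?linear0.
by rewrite (residue_morph g _ mL) /= um.
Qed.

(** * Fields and normally ordered products *)

Section Fields.
Variables (R : comNzRingType) (W : lmodType R).

Definition is_field : {pred int -> W -> W} :=
  [pred a | `[< (forall n, linear (a n)) /\ forall w, exists A, order_ge A (a^~ w) >]].

Lemma is_field_submod_closed : submod_closed is_field.
Proof.
split=> [|k a b /asboolP[aL aT] /asboolP[bL bT]]; apply/asboolP; split=> [n c x y|w].
- by rewrite scaler0 addr0.
- by exists 0.
- by rewrite !fctE aL bL !scalerDr !scalerA addrACA mulrC.
have [A hA] := aT w; have [B hB] := bT w; exists (Num.min A B) => n hn.
by rewrite !fctE hA ?hB ?scaler0 ?addr0 //; lia.
Qed.
HB.instance Definition _ :=
  GRing.isSubmodClosed.Build R (int -> W -> W) is_field is_field_submod_closed.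

(* [a n] is the coefficient of [x^n] in the field [a(x)] of [Hom(W, W((x)))]. *)
Record vfield := VField { vcoef :> int -> W -> W; vcoef_is_field : vcoef \in is_field }.

HB.instance Definition _ := [isSub for vcoef].
HB.instance Definition _ := [Choice of vfield by <:].
HB.instance Definition _ := [SubChoice_isSubLmodule of vfield by <:].

Implicit Types (a b c : vfield) (w x y : W) (i n e t : int) (k : R).

Lemma vfieldP a b : (forall n w, a n w = b n w) -> a = b.
Proof. by move=> ab; apply/val_inj/funext => n; apply/funext => w; exact: ab. Qed.

Lemma vcoef_linear a n : linear (a n).
Proof. by have /asboolP[aL _] := vcoef_is_field a; exact: aL. Qed.
HB.instance Definition _ a n := GRing.isLinear.Build R W W *:%R (vcoef a n) (vcoef_linear a n).

Lemma vcoef_trunc a w : exists A, order_ge A (a^~ w).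
Proof. by have /asboolP[_] := vcoef_is_field a. Qed.

Lemma vcoef_trunc_itv a (F : int -> W) (lo hi : int) :
  exists A, forall i n, lo <= i < hi -> n < A -> a n (F i) = 0.
Proof.
have [hi_lo|lo_hi] := ltP hi lo; first by exists 0 => i n ?; lia.
have [N hiE] : exists N : nat, hi = lo + N%:Z by exists (absz (hi - lo)%R); lia.
rewrite {hi lo_hi}hiE; elim: N => [|N [A hA]]; first by exists 0 => i n ?; lia.
have [B hB] := vcoef_trunc a (F (lo + N%:Z)); exists (Num.min A B) => i n hi hn.
have [iN|iN] := ltP i (lo + N%:Z); first by apply: hA; lia.
by rewrite (_ : i = lo + N%:Z) ?hB //; lia.
Qed.

Lemma vcoefD a b n w : (a + b) n w = a n w + b n w. Proof. by []. Qed.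
Lemma vcoefN a n w : (- a) n w = - a n w. Proof. by rewrite -[in LHS]scaleN1r -[RHS]scaleN1r. Qed.
Lemma vcoefB a b n w : (a - b) n w = a n w - b n w.
Proof. by rewrite vcoefD vcoefN. Qed.
Lemma vcoefZ k a n w : (k *: a) n w = k *: a n w. Proof. by []. Qed.

Definition vfield_eval n w a : W := a n w.

Lemma vfield_eval_linear n w : linear (vfield_eval n w).
Proof. by []. Qed.
HB.instance Definition _ n w :=
  GRing.isLinear.Build R vfield W *:%R (vfield_eval n w) (vfield_eval_linear n w).

Lemma vcoef_sum (I : Type) (r : seq I) (P : pred I) (F : I -> vfield) n w :
  (\sum_(i <- r | P i) F i) n w = \sum_(i <- r | P i) F i n w.
Proof. exact: (linear_sum (vfield_eval n w)). Qed.

Lemma is_field_intro (f : int -> W -> W) : (forall n, linear (f n)) ->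
  (forall w, exists A, order_ge A (f^~ w)) -> f \in is_field.
Proof. by move=> fL fT; apply/asboolP. Qed.

Lemma id_is_field : (fun n w => if n == 0 then w else 0) \in is_field.
Proof.
apply: is_field_intro => [n k x y|w]; first by case: ifP; rewrite ?scaler0 ?addr0.
by exists 0 => n hn; rewrite lt_eqF.
Qed.

Definition id_field : vfield := VField id_is_field.

Lemma id_fieldE n w : id_field n w = if n == 0 then w else 0. Proof. by []. Qed.

Lemma weight_is_field (p : int -> R) a : (fun n w => p n *: a n w) \in is_field.
Proof.
apply: is_field_intro => [n k x y|w]; first by rewrite linearP scalerDr !scalerA mulrC.
by have [A hA] := vcoef_trunc a w; exists A => n hn; rewrite hA ?scaler0.
Qed.

Definition weight p a : vfield := VField (weight_is_field p a).

Lemma weightE p a n w : weight p a n w = p n *: a n w. Proof. by []. Qed.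

Definition euler a : vfield := weight (fun n => n%:~R) a.

Lemma eulerE a n w : euler a n w = n%:~R *: a n w. Proof. by []. Qed.

Lemma euler_linear : linear euler.
Proof.
move=> k a b; apply: vfieldP => n w.
by rewrite vcoefD vcoefZ !eulerE scalerDr !scalerA mulrC.
Qed.
HB.instance Definition _ := GRing.isLinear.Build R vfield vfield *:%R euler euler_linear.

Lemma euler_id : euler id_field = 0.
Proof.
by apply: vfieldP => n w; rewrite eulerE id_fieldE; case: eqP => [->|_]; rewrite ?scale0r ?scaler0.
Qed.

(* [ad a t c] is [x^t [a_t, c(x)]]. *)
Lemma ad_is_field a t c :
  (fun e w => a t (c (e - t) w) - c (e - t) (a t w)) \in is_field.
Proof.
apply: is_field_intro => [n k x y|w] /=; first by rewrite !linearP scalerDr addrACA.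
have [A hA] := vcoef_trunc c w; have [B hB] := vcoef_trunc c (a t w).
by exists (Num.min A B + t) => n hn; rewrite hA ?hB ?(linear0 (a t)) ?subr0 //; lia.
Qed.

Definition ad a t c : vfield := VField (ad_is_field a t c).

Lemma adE a t c e w : ad a t c e w = a t (c (e - t) w) - c (e - t) (a t w).
Proof. by []. Qed.

Lemma ad_linear a t : linear (ad a t).
Proof.
move=> k b c; apply: vfieldP => e w; rewrite vcoefD vcoefZ !adE !vcoefD !vcoefZ linearP.
by rewrite scalerBr opprD addrACA.
Qed.
HB.instance Definition _ a t := GRing.isLinear.Build R vfield vfield *:%R (ad a t) (ad_linear a t).

Definition nop_term a t c e w (i : int) : W :=
  if t <= i then a i (c (e - i) w) else c (e - i) (a i w).

Lemma bounded_supp_nop_term a t c e w : bounded_supp (nop_term a t c e w).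
Proof.
have [A hA] := vcoef_trunc c w; have [B hB] := vcoef_trunc a w.
exists (Num.min B t), (Num.max (e - A + 1) t) => i hi; rewrite /nop_term.
case: ifP => ti; first by rewrite hA ?linear0 //; lia.
by rewrite hB ?linear0 //; lia.
Qed.

Lemma nop_is_field a t c : (fun e w => zsum (nop_term a t c e w)) \in is_field.
Proof.
apply: is_field_intro => [e k x y|w].
  rewrite -zsumZ -?zsumD; try exact: bounded_supp_nop_term.
    by apply: eq_zsum => i; rewrite /nop_term; case: ifP => _; rewrite !linearP.
  exact/bounded_suppZ/bounded_supp_nop_term.
have [A hA] := vcoef_trunc c w; have [B hB] := vcoef_trunc a w.
have [D hD] := vcoef_trunc_itv c (a^~ w) B t.
exists (Num.min (A + t) (D + Num.min B t)) => e he; apply: zsum0 => i; rewrite /nop_term.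
case: ifP => ti; first by rewrite hA ?linear0 //; lia.
have [hi|hi] := ltP i B; first by rewrite hB ?linear0.
by rewrite hD //; lia.
Qed.

(* The normally ordered product [\sum_(i >= t) x^i a_i c(x) + \sum_(i < t) c(x) x^i a_i]. *)
Definition nop a t c : vfield := VField (nop_is_field a t c).

Lemma nopE a t c e w : nop a t c e w = zsum (nop_term a t c e w). Proof. by []. Qed.

#[local] Arguments vcoef : simpl never.

Lemma nop_linear a t : linear (nop a t).
Proof.
move=> k b c; apply: vfieldP => e w; rewrite vcoefD vcoefZ !nopE -zsumZ -?zsumD;
  try exact: bounded_supp_nop_term; last exact/bounded_suppZ/bounded_supp_nop_term.
by apply: eq_zsum => i; rewrite /nop_term !vcoefD !vcoefZ; case: ifP => _; rewrite ?linearP.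
Qed.
HB.instance Definition _ a t :=
  GRing.isLinear.Build R vfield vfield *:%R (nop a t) (nop_linear a t).

Lemma nop_linearl t c : linear (fun a => nop a t c).
Proof.
move=> k a b; apply: vfieldP => e w; rewrite vcoefD vcoefZ !nopE -zsumZ -?zsumD;
  try exact: bounded_supp_nop_term; last exact/bounded_suppZ/bounded_supp_nop_term.
by apply: eq_zsum => i; rewrite /nop_term !vcoefD !vcoefZ; case: ifP => _; rewrite ?linearP.
Qed.

Lemma diff_nop a c : diff (fun t => nop a t c) = fun t => ad a t c.
Proof.
apply: funext => t; apply: vfieldP => e w; rewrite diffE vcoefB !nopE adE.
rewrite -zsumB; try exact: bounded_supp_nop_term.
rewrite (@zsum_single _ t) => [|i hi]; rewrite /nop_term.
  by rewrite lexx ifF //; lia.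
case: (leP t i) => ti; first by rewrite ifT ?subrr //; lia.
by rewrite ifF ?subrr //; lia.
Qed.

Lemma ad_euler a t c : ad (euler a) t c = t%:~R *: ad a t c.
Proof. by apply: vfieldP => e w; rewrite vcoefZ !adE !eulerE linearZ scalerBr. Qed.

Lemma euler_nop a t c : euler (nop a t c) = nop (euler a) t c + nop a t (euler c).
Proof.
apply: vfieldP => e w; rewrite vcoefD eulerE !nopE -zsumZ -?zsumD;
  try exact: bounded_supp_nop_term.
apply: eq_zsum => i; rewrite /nop_term !eulerE; case: ifP => _;
  by rewrite linearZ /= -scalerDl -rmorphD /= (addrC i) subrK.
Qed.

Lemma nop_id a t : nop a t id_field = a.
Proof.
apply: vfieldP => e w; rewrite nopE (@zsum_single _ e) /nop_term => [|i hi].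
  by rewrite !id_fieldE subrr eqxx; case: ifP.
by rewrite !id_fieldE subr_eq0 eq_sym (negPf hi) linear0; case: ifP.
Qed.

Lemma id_nop c t : nop id_field t c = c.
Proof.
apply: vfieldP => e w; rewrite nopE (@zsum_single _ 0) /nop_term => [|i hi].
  by rewrite !id_fieldE eqxx subr0; case: ifP.
by rewrite !id_fieldE (negPf hi) linear0; case: ifP.
Qed.

Lemma ad_id a t : ad a t id_field = 0.
Proof. by have /(congr1 (@^~ t)) := diff_nop a id_field; rewrite diffE !nop_id subrr. Qed.

(* Commutation with [c_p] is a derivation; multiplying the result by [x^p] moves the splitting
   index of its first term from [t] to [t + p]. *)
Lemma ad_nop c p a t b : ad c p (nop a t b) = nop (ad c p a) (t + p) b + nop a t (ad c p b).
Proof.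
have term_fin := bounded_supp_nop_term; apply: vfieldP => e w; rewrite vcoefD adE !nopE.
rewrite -(zsum_morph (linearD (c p)) (term_fin a t b (e - p) w)).
rewrite -(zsum_shift p (nop_term (ad c p a) (t + p) b e w)).
have fin_c := bounded_supp_comp (linear0 (c p)) (term_fin a t b (e - p) w).
rewrite -zsumB // -zsumD //; last exact: (bounded_supp_shift p (term_fin _ _ _ _ _)).
apply: eq_zsum => i; rewrite /nop_term lerD2r !adE addrK.
rewrite (_ : e - (i + p) = e - p - i); last by lia.
rewrite (_ : e - i - p = e - p - i); last by lia.
case: ifP => _; first by rewrite linearB /= subrKA.
by rewrite linearB /= [RHS]addrC subrKA.
Qed.

End Fields.

Arguments vcoef : simpl never.
Arguments id_field {R W}.

Section Locality.
Variables (R : comNzRingType) (W : lmodType R).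
Notation vfield := (@vfield R W).
Implicit Types (a b c : vfield) (w : W) (e p t : int) (K : nat).

Definition local_order K a c : Prop := degree_lt K (fun t => ad a t c).

Definition local a c : Prop := exists K, local_order K a c.

Lemma local_orderW K L a c : (K <= L)%N -> local_order K a c -> local_order L a c.
Proof. exact: degree_ltW. Qed.

Lemma local_order_common a c a' c' : local a c -> local a' c' ->
  exists K, local_order K a c /\ local_order K a' c'.
Proof.
move=> [K acK] [L acL]; exists (maxn K L).
by split; [apply: local_orderW acK; exact: leq_maxl|apply: local_orderW acL; exact: leq_maxr].
Qed.

Lemma degree_lt_nop K a c : local_order K a c -> degree_lt K.+1 (fun t => nop a t c).
Proof. by move=> acK; apply/degree_ltS; rewrite diff_nop. Qed.

Lemma iter_diff_vcoef (u : int -> vfield) K t e w :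
  iter K (@diff _) u t e w = iter K (@diff _) (fun s => u s e w) t.
Proof. exact/esym/(congr1 (@^~ t) (iter_diff_morph K u (linearB (vfield_eval e w)))). Qed.

Lemma degree_lt_vcoefP K (u : int -> vfield) :
  degree_lt K u <-> forall e w, degree_lt K (fun t => u t e w).
Proof.
split=> [uK e w t|uK t]; first by rewrite -iter_diff_vcoef uK.
by apply: vfieldP => e w; rewrite iter_diff_vcoef uK.
Qed.

Lemma local_order_sym K a c : local_order K a c -> local_order K c a.
Proof.
move=> /degree_lt_vcoefP acK; apply/degree_lt_vcoefP => e w.
have -> : (fun t => ad c t a e w) = fun t => - ad a (e - t) c e w.
  by apply: funext => t; rewrite !adE subKr opprB.
exact: degree_ltN (degree_lt_rev e (acK e w)).
Qed.

Lemma local_sym a c : local a c -> local c a.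
Proof. by case=> K acK; exists K; exact: local_order_sym. Qed.

Lemma local_predr a : submodule_pred (local a).
Proof.
split=> [|k b c ab ac].
  by exists 0%N => t; rewrite /= linear0.
have [K [abK acK]] := local_order_common ab ac; exists K; rewrite /local_order.
under eq_fun do rewrite linearP.
by apply: degree_ltD acK; apply: (degree_lt_morph (g := *:%R k)) abK; exact: scalerBr.
Qed.

Lemma local_predl c : submodule_pred (local^~ c).
Proof.
have [c0 cP] := local_predr c; split=> [|k a b ac bc]; apply: local_sym => //.
by apply: cP; exact: local_sym.
Qed.

Lemma local_order_euler K a c : local_order K a c -> local_order K.+1 (euler a) c.
Proof.
by move=> /degree_lt_mulz acK; rewrite /local_order; under eq_fun do rewrite ad_euler.
Qed.

Lemma local_euler a c : local a c -> local (euler a) c.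
Proof. by case=> K /local_order_euler; exists K.+1. Qed.

Lemma local_iter_euler (j : nat) a c : local a c -> local (iter j (@euler R W) a) c.
Proof. by move=> ac; elim: j => // j IH; exact: local_euler. Qed.

Lemma local_id a : local a id_field.
Proof. by exists 0%N => t; rewrite /= ad_id. Qed.

(* The Jacobi identity [b_q, [c_p, a]] = [[b_q, c_p], a] + [c_p, [b_q, a]]. *)
Lemma ad_jacobi a b c p e f w :
  ad b (e - p) (ad c p a) f w =
  ad c p (ad b (e - p) a) f w - (ad c p b e (a (f - e) w) - a (f - e) (ad c p b e w)).
Proof.
rewrite !adE !linearB /= (_ : f - (e - p) - p = f - e); last by lia.
rewrite (_ : f - p - (e - p) = f - e); last by lia.
rewrite !opprK [RHS](AC ((2*2)*(2*2)) (((6*3)*(2*7))*((1*5)*(4*8)))) /=.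
by rewrite !subrr !addr0.
Qed.

Lemma local_order_ad K a b c : local_order K b a -> local_order K c a -> local_order K c b ->
  forall q, local_order (K + K + K) c (ad b q a).
Proof.
move=> baK caK /degree_lt_vcoefP cbK q; apply/degree_lt_vcoefP => f w.
apply: (degree_lt_dong (F := fun p q => ad c p (ad b q a) f w)
  (G := fun p q => ad b q (ad c p a) f w)) => [p|r|e].
- have := degree_lt_morph (linearB (ad c p)) baK.
  by move/degree_lt_vcoefP; apply.
- have := degree_lt_morph (linearB (ad b r)) caK.
  by move/degree_lt_vcoefP; apply.
under eq_fun do rewrite ad_jacobi subKr.
apply: degree_ltB; first exact: cbK.
exact: (degree_lt_morph (linearB (a (f - e))) (cbK e w)).
Qed.

Lemma local_nop a b c t : local a b -> local a c -> local b c -> local (nop a t b) c.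
Proof.
move=> ab /local_sym ca [L /local_order_sym cbL]; apply: local_sym.
have [N [abN caN]] := local_order_common ab ca; pose K := maxn N L.
have {abN} baK := local_orderW (leq_maxl N L) (local_order_sym abN).
have {caN} caK := local_orderW (leq_maxl N L) caN.
have {cbL} cbK := local_orderW (leq_maxr N L) cbL.
exists ((K + K + K).+1 + K)%N; rewrite /local_order; under eq_fun do rewrite ad_nop.
apply: degree_ltD.
  rewrite addnC.
  apply: (degree_lt_diagonal (F := fun s p => nop (ad c p a) (t + s) b)) => [s|p].
    exact: (degree_lt_morph (zmod_morphism_linear (nop_linearl (t + s) b)) caK).
  under eq_fun do rewrite addrC.
  apply: (degree_lt_shift t (u := fun s => nop (ad c p a) s b)).
  apply/degree_lt_nop/local_order_sym/local_order_ad => //; exact: local_order_sym.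
apply: degree_ltW (leq_addl _ _) _.
exact: (degree_lt_morph (linearB (nop a t)) cbK).
Qed.

End Locality.

(** * Products of local fields *)

Section Products.
Variables (R : numFieldType) (W : lmodType R).
Notation vfield := (@vfield R W).
Implicit Types (a b c d : vfield) (g h : laurent R) (w : W) (e n t : int) (j K : nat)
  (k : R) (p : {poly R}).

(* For [n >= -1] the products are the modes of the normally ordered product; the others are
   forced by [(x a')_n c = - n a_(n-1) c]. *)
Definition nprod a n c : vfield :=
  if n is Negz j then (j`!%:R)^-1 *: modes (fun t => nop (iter j (@euler R W) a) t c) (-1)
  else modes (fun t => nop a t c) n.

Definition resprod h a c : vfield := residue h (fun n => nprod a n c).

Lemma nprod_ge a n c : -1 <= n -> nprod a n c = modes (fun t => nop a t c) n.
Proof. by case: n => [//|[|n]] // _; rewrite /nprod fact0 invr1 scale1r. Qed.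

Lemma nprod_Negz a j c :
  nprod a (Negz j) c = (j`!%:R)^-1 *: nprod (iter j (@euler R W) a) (-1) c.
Proof. by rewrite [in RHS]nprod_ge. Qed.

Lemma upper_trunc_nprod K a c : local_order K a c -> upper_trunc K (fun n => nprod a n c).
Proof.
move=> /degree_lt_nop/modesP[_ trunc] n hn; rewrite nprod_ge; last by lia.
by apply: trunc; lia.
Qed.

Lemma nop_resprod a t c : local a c -> nop a t c = resprod (lkernel t%:~R) a c.
Proof.
case=> K /degree_lt_nop/modesP[[_ _ ->] _].
by apply: eq_residue (@order_ge_lkernel R t%:~R) _ => n hn; rewrite nprod_ge.
Qed.

Lemma ad_resprod a t c : local a c -> ad a t c = resprod (lexp (- t%:~R)) a c.
Proof.
move=> ac; have [K acK] := ac; have := congr1 (@^~ t) (diff_nop a c).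
rewrite diffE !nop_resprod // => <-.
by rewrite -(residueBl _ _ (upper_trunc_nprod acK)) rmorphD lkernelB.
Qed.

Lemma nprod_eq_of_ad K a c (v : int -> vfield) : upper_trunc K%:Z v ->
  (forall t, ad a t c = residue (lexp (- t%:~R)) v) -> forall n, 0 <= n -> nprod a n c = v n.
Proof.
move=> vK adv.
have acK : local_order K a c.
  rewrite /local_order; under eq_fun do rewrite adv -[lexp _]mulr1.
  exact: (degree_lt_residue vK (@order_ge1 R)).
have ac : local a c by exists K.
have nK := upper_trunc_nprod acK; move=> n hn; apply/eqP; rewrite -subr_eq0.
rewrite -scaleN1r addrC; apply/eqP; pose d i := -1 *: v i + nprod a i c; rewrite -/(d n).
have dK : upper_trunc K%:Z d by move=> i hi; rewrite /d vK ?nK ?scaler0 ?addr0.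
apply: (residue_lexp_inj dK (@order_ge1 R)) hn => [|t]; first by rewrite lcoef1.
by rewrite mulr1 (residue_linearr _ _ vK nK) -adv -[residue _ _]ad_resprod // scaleN1r addNr.
Qed.

Lemma nprod_linearr k a c c' n : local a c -> local a c' ->
  nprod a n (k *: c + c') = k *: nprod a n c + nprod a n c'.
Proof.
have modes_lin b i : local b c -> local b c' -> modes (fun t => nop b t (k *: c + c')) i =
    k *: modes (fun t => nop b t c) i + modes (fun t => nop b t c') i.
  move=> [K bcK] [L bcL]; under eq_fun do rewrite linearP.
  by rewrite (modes_linear _ (degree_lt_nop bcK) (degree_lt_nop bcL)).
move=> ac ac'; case: n => n; rewrite /nprod modes_lin //; try exact: local_iter_euler.
by rewrite scalerDr !scalerA mulrC.
Qed.

Lemma iter_euler_linear j : linear (iter j (@euler R W)).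
Proof. by elim: j => // j IH k a b; rewrite !iterS IH linearP. Qed.

Lemma nprod_linearl k a a' c n : local a c -> local a' c ->
  nprod (k *: a + a') n c = k *: nprod a n c + nprod a' n c.
Proof.
have modes_lin b b' i : local b c -> local b' c -> modes (fun t => nop (k *: b + b') t c) i =
    k *: modes (fun t => nop b t c) i + modes (fun t => nop b' t c) i.
  move=> [K bcK] [L bcL]; under eq_fun => t do rewrite (nop_linearl t c).
  by rewrite (modes_linear _ (degree_lt_nop bcK) (degree_lt_nop bcL)).
move=> ac ac'; case: n => n; rewrite /nprod ?iter_euler_linear modes_lin //;
  try exact: local_iter_euler.
by rewrite scalerDr !scalerA mulrC.
Qed.

Lemma nprod0r a n : nprod a n 0 = 0.
Proof.
have a0 : local a 0 := (local_predr a).1.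
by have := nprod_linearr (-1) n a0 a0; rewrite scaler0 addr0 scaleN1r addNr.
Qed.

Lemma nprod0l n c : nprod 0 n c = 0.
Proof.
have c0 : local 0 c := (local_predl c).1.
by have := nprod_linearl (-1) n c0 c0; rewrite scaler0 addr0 scaleN1r addNr.
Qed.

Lemma nprodZl k a n c : local a c -> nprod (k *: a) n c = k *: nprod a n c.
Proof.
move=> ac; rewrite -[k *: a]addr0 nprod_linearl ?nprod0l ?addr0 //.
exact: (local_predl c).1.
Qed.

Lemma local_nprod a b c n : local a b -> local a c -> local b c -> local (nprod a n b) c.
Proof.
have local_modes a' i : local a' b -> local a' c -> local b c ->
    local (modes (fun t => nop a' t b) i) c.
  move=> a'b a'c bc; have [K /degree_lt_nop a'bK] := a'b.
  by apply: (modes_pred (local_predl c) a'bK) => t; exact: local_nop.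
move=> ab ac bc; case: n => n; rewrite /nprod; first exact: local_modes.
by apply: (submodule_predZ (local_predl c)); apply: local_modes => //; exact: local_iter_euler.
Qed.

Lemma local_nprodr a b c n : local a b -> local a c -> local b c -> local a (nprod b n c).
Proof. by move=> ab ac bc; apply/local_sym/local_nprod => //; exact: local_sym. Qed.

Lemma local_resprodr a b c h : local a b -> local a c -> local b c -> local a (resprod h b c).
Proof.
move=> ab ac bc; apply: (submodule_pred_zsum (local_predr a)) => n.
exact/(submodule_predZ (local_predr a))/local_nprodr.
Qed.

Lemma nprod_euler_ge0 a c n : local a c -> 0 <= n ->
  nprod (euler a) n c = - (n%:~R *: nprod a (n - 1) c).
Proof.
move=> ac hn; have [K acK] := ac; have trunc := upper_trunc_nprod acK.
pose v i := - (i%:~R *: nprod a (i - 1) c).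
have vK : upper_trunc K.+1 v.
  by move=> i hi; rewrite /v trunc ?scaler0 ?oppr0 //; lia.
apply: (nprod_eq_of_ad (v := v) vK) hn => t.
rewrite ad_euler ad_resprod // -(residueZl _ _ trunc).
have -> : lconst t%:~R * lexp (- t%:~R : R) = lconst (-1) * lderiv (lexp (- t%:~R)).
  by rewrite lderiv_lexp !rmorphN rmorph1; ring.
rewrite (residueZl _ _ trunc) residue_lderiv scaleN1r /residue -zsumN.
  by apply: eq_zsum => i; rewrite scalerN.
by apply: (@bounded_supp_residue _ _ _ _ K.+1) => i hi; rewrite trunc ?scaler0 //; lia.
Qed.

Lemma nprod_euler a c n : local a c -> nprod (euler a) n c = - (n%:~R *: nprod a (n - 1) c).
Proof.
move=> ac; case: n => [n|j]; first exact: nprod_euler_ge0.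
rewrite (_ : Negz j - 1 = Negz j.+1); last by lia.
rewrite (nprod_Negz (euler a)) (nprod_Negz a j.+1) -iterSr -scaleNr [RHS]scalerA; congr (_ *: _).
rewrite NegzE mulrNz opprK -pmulrn factS natrM invfM mulrA mulfV ?mul1r //.
by rewrite pnatr_eq0.
Qed.

Lemma euler_nprod a n c : local a c ->
  euler (nprod a n c) = nprod (euler a) n c + nprod a n (euler c).
Proof.
have modes_D b i : local b c -> euler (modes (fun t => nop b t c) i) =
    modes (fun t => nop (euler b) t c) i + modes (fun t => nop b t (euler c)) i.
  move=> bc; have [K /degree_lt_nop bcK] := bc.
  have [L /degree_lt_nop b'cL] := local_euler bc.
  have [N /degree_lt_nop bc'N] := local_sym (local_euler (local_sym bc)).
  have := modes_morph (@euler R W) bcK; move/(congr1 (@^~ i)) => /= <-.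
  have := modes_linear 1 b'cL bc'N; move/(congr1 (@^~ i)); rewrite scale1r => <-.
  by congr (modes _ _); apply: funext => t; rewrite /= euler_nop scale1r.
move=> ac; case: n => j; rewrite /nprod ?modes_D //.
by rewrite linearZ /= modes_D ?scalerDr -?iterS -?iterSr //; exact: local_iter_euler.
Qed.

Lemma nprod_id a n :
  nprod a n id_field = if n is Negz j then (j`!%:R)^-1 *: iter j (@euler R W) a else 0.
Proof.
have modes_id b : modes (fun t => nop b t id_field) = delta_mode (-1) b.
  by under eq_fun do rewrite nop_id; exact: modes_cst.
by case: n => n; rewrite /nprod modes_id.
Qed.

Lemma nprodN1_id a : nprod a (-1) id_field = a.
Proof. by rewrite nprod_id /= fact0 invr1 scale1r. Qed.

Lemma id_nprod n c : nprod id_field n c = delta_mode (-1) c n.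
Proof.
have modes_id : modes (fun t => nop id_field t c) = delta_mode (-1) c.
  by under eq_fun do rewrite id_nop; exact: modes_cst.
have [hn|hn] := leP (-1) n; first by rewrite nprod_ge ?modes_id.
case: n hn => // -[|j] // _; rewrite nprod_Negz iterSr euler_id.
have -> : iter j (@euler R W) 0 = 0 by elim: j => // j IH; rewrite iterS IH linear0.
by rewrite nprod0l scaler0.
Qed.

Lemma resprod_linearl k g h a c : local a c ->
  resprod (lconst k * g + h) a c = k *: resprod g a c + resprod h a c.
Proof. by case=> K acK; exact: (residue_linearl (upper_trunc_nprod acK)). Qed.

Lemma resprodZl k h a c : local a c -> resprod (lconst k * h) a c = k *: resprod h a c.
Proof. by case=> K acK; exact: (residueZl _ _ (upper_trunc_nprod acK)). Qed.

Lemma resprodDl g h a c : local a c -> resprod (g + h) a c = resprod g a c + resprod h a c.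
Proof. by case=> K acK; exact: (residueDl _ _ (upper_trunc_nprod acK)). Qed.

Lemma resprodBl g h a c : local a c -> resprod (g - h) a c = resprod g a c - resprod h a c.
Proof. by case=> K acK; exact: (residueBl _ _ (upper_trunc_nprod acK)). Qed.

Lemma resprod_suml (I : Type) (r : seq I) (F : I -> laurent R) a c : local a c ->
  resprod (\sum_(i <- r) F i) a c = \sum_(i <- r) resprod (F i) a c.
Proof. by case=> K acK; exact: (residue_suml _ _ (upper_trunc_nprod acK)). Qed.

Lemma resprod_order_ge K h a c : local_order K a c -> order_ge K h -> resprod h a c = 0.
Proof. by move=> /upper_trunc_nprod; exact: residue_order_ge. Qed.

Lemma resprod_linearr h k a c c' : local a c -> local a c' ->
  resprod h a (k *: c + c') = k *: resprod h a c + resprod h a c'.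
Proof.
move=> ac ac'; have [K [acK ac'K]] := local_order_common ac ac'.
rewrite -(residue_linearr _ _ (upper_trunc_nprod acK) (upper_trunc_nprod ac'K)).
by apply: eq_zsum => n; rewrite nprod_linearr.
Qed.

Lemma resprod0r h a : resprod h a 0 = 0.
Proof. by apply: zsum0 => n; rewrite nprod0r scaler0. Qed.

Lemma resprodZr h k a c : local a c -> resprod h a (k *: c) = k *: resprod h a c.
Proof.
move=> ac; rewrite -[k *: c]addr0 resprod_linearr ?resprod0r ?addr0 //.
exact: (local_predr a).1.
Qed.

Lemma resprodNr h a c : local a c -> resprod h a (- c) = - resprod h a c.
Proof. by move=> ac; rewrite -scaleN1r resprodZr // scaleN1r. Qed.

Lemma resprodZm h k a c : local a c -> resprod h (k *: a) c = k *: resprod h a c.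
Proof.
move=> ac; have [K acK] := ac.
rewrite /resprod /residue -zsumZ; last exact: bounded_supp_residue (upper_trunc_nprod acK).
by apply: eq_zsum => n; rewrite nprodZl // !scalerA mulrC.
Qed.

Lemma resprodDm h a a' c : local a c -> local a' c ->
  resprod h (a + a') c = resprod h a c + resprod h a' c.
Proof.
move=> [K acK] [K' acK'].
have fin := bounded_supp_residue h (upper_trunc_nprod acK).
have fin' := bounded_supp_residue h (upper_trunc_nprod acK').
rewrite /resprod /residue -zsumD //; apply: eq_zsum => n; rewrite -scalerDr; congr (_ *: _).
have := nprod_linearl 1 n (ex_intro _ K acK) (ex_intro _ K' acK').
by rewrite !scale1r.
Qed.

Lemma resprod0m h c : resprod h 0 c = 0.
Proof. by apply: zsum0 => n; rewrite nprod0l scaler0. Qed.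

Lemma resprod_mon n a c : resprod (lmon n) a c = nprod a n c.
Proof. exact: residue_mon. Qed.

Lemma resprod_euler h a c : local a c -> resprod h (euler a) c = - resprod (lderiv h) a c.
Proof.
move=> ac; have [K acK] := local_euler ac.
rewrite /resprod residue_lderiv /residue -zsumN.
  by apply: eq_zsum => n; rewrite nprod_euler // scalerN.
apply: (@bounded_supp_residue _ _ _ _ K) => n hn; apply: oppr_inj.
by rewrite -nprod_euler // oppr0 (upper_trunc_nprod acK).
Qed.

Lemma resprod_eval h a c e w : local a c ->
  resprod h a c e w = residue h (fun n => nprod a n c e w).
Proof.
by case=> K acK; rewrite (residue_morph (vfield_eval e w) _ (upper_trunc_nprod acK)).
Qed.

Lemma nop_weight p a t c : local a c ->
  nop (weight (fun n => p.[n%:~R]) a) t c = resprod (pderiv (lkernel t%:~R) p) a c.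
Proof.
elim/poly_ind: p a => [|p k IH] a ac.
  rewrite pderiv0 [resprod _ _ _]residue0l (_ : weight _ a = 0).
    by have := nop_linearl t c (-1) 0 0; rewrite scaler0 addr0 scaleN1r addNr.
  by apply: vfieldP => n w; rewrite weightE horner0 scale0r.
have -> : weight (fun n => (p * 'X + k%:P).[n%:~R]) a =
    k *: a + weight (fun n => p.[n%:~R]) (euler a).
  apply: vfieldP => n w; rewrite vcoefD vcoefZ weightE (weightE _ (euler a)) eulerE.
  by rewrite hornerMXaddC scalerA -scalerDl addrC.
rewrite (nop_linearl t c) IH; last exact: local_euler.
by rewrite resprod_euler // pderiv_cons resprodBl // resprodZl // nop_resprod.
Qed.

Lemma continuous_resprod a c : local a c -> continuous_functional (fun h => resprod h a c).
Proof. by case=> K acK; exact: continuous_functional_residue (upper_trunc_nprod acK). Qed.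

End Products.

Arguments nprod : simpl never.

(** * The commutator formula *)

Section NestedProducts.
Variables (R : comNzRingType) (W : lmodType R).
Notation vfield := (@vfield R W).
Implicit Types (a b c : vfield) (w : W) (i j e s t : int).

Definition nop2_term a s b t c e w i j : W :=
  if s <= i then a i (nop_term b t c (e - i) w j) else nop_term b t c (e - i) (a i w) j.

Lemma nop_nop a s b t c e w :
  nop a s (nop b t c) e w = \zsum_i \zsum_j nop2_term a s b t c e w i j.
Proof.
rewrite nopE; apply: eq_zsum => i; rewrite {1}/nop_term /nop2_term; case: ifP => _ //.
by rewrite nopE (zsum_morph (linearD (a i))) //; exact: bounded_supp_nop_term.
Qed.

Lemma bounded_supp2_nop2_term a s b t c e w : bounded_supp2 (nop2_term a s b t c e w).
Proof.
have [D hc] := vcoef_trunc c w; have [B hb] := vcoef_trunc b w; have [A ha] := vcoef_trunc a w.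
have [Db hcb] := vcoef_trunc_itv c (b^~ w) B t.
have [Da hca] := vcoef_trunc_itv c (a^~ w) A s.
have [Ba hba] := vcoef_trunc_itv b (a^~ w) A s.
exists (Num.min (Num.min A s) (Num.min (Num.min B t) Ba)).
exists (Num.max (Num.max (Num.max s t) (Num.max (e - D - t + 1) (e - D - s + 1)))
  (Num.max (e - Db - B + 1) (e - Da - A + 1))) => i j hij.
rewrite /nop2_term /nop_term; have [si|si] := leP s i; have [tj|tj] := leP t j.
- by rewrite hc ?linear0 //; lia.
- have [jB|jB] := ltP j B; first by rewrite hb ?linear0.
  by rewrite hcb ?linear0 //; lia.
- have [iA|iA] := ltP i A; first by rewrite ha ?linear0.
  by rewrite hca ?linear0 //; lia.
- have [iA|iA] := ltP i A; first by rewrite ha ?linear0.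
  by rewrite hba ?linear0 //; lia.
Qed.

Lemma nop2_termB a s b t c e w i j :
  nop2_term a s b t c e w i j - nop2_term b t a s c e w j i =
  (if (s <= i) && (t <= j) then ad a i b (i + j) (c (e - (i + j)) w) else 0) -
  (if (i < s) && (j < t) then c (e - (i + j)) (ad a i b (i + j) w) else 0).
Proof.
rewrite /nop2_term /nop_term !adE (_ : e - i - j = e - (i + j)); last by lia.
rewrite (_ : e - j - i = e - (i + j)); last by lia.
rewrite (_ : i + j - i = j); last by lia.
have [hi|hi] := leP s i; have [hj|hj] := leP t j; rewrite /= ?subr0 ?subrr //.
by rewrite linearB opprB add0r.
Qed.

Lemma nop_commutator_coef a s b t c e w :
  (nop a s (nop b t c) - nop b t (nop a s c)) e w =
  \zsum_x (\zsum_i (if s <= i < x - t + 1 then ad a i b x (c (e - x) w) else 0) -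
           \zsum_i (if x - t + 1 <= i < s then c (e - x) (ad a i b x w) else 0)).
Proof.
have fin := bounded_supp2_nop2_term a s b t c e w.
have fin' := bounded_supp2_swap (bounded_supp2_nop2_term b t a s c e w).
rewrite vcoefB !nop_nop (zsum_exchange (bounded_supp2_nop2_term b t a s c e w)).
rewrite (zsum_shear fin) (zsum_shear fin').
have sheared := bounded_supp2_swap (bounded_supp2_shear fin).
have sheared' := bounded_supp2_swap (bounded_supp2_shear fin').
rewrite -(zsumB (bounded_supp2_zsum sheared) (bounded_supp2_zsum sheared')).
apply: eq_zsum => x.
rewrite -(zsumB (bounded_supp2_row x sheared) (bounded_supp2_row x sheared')).
rewrite -zsumB; try exact: bounded_supp_if.
apply: eq_zsum => i; rewrite nop2_termB (_ : i + (x - i) = x); last by lia.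
rewrite (_ : (s <= i < x - t + 1) = (s <= i) && (t <= x - i)); last by lia.
by rewrite (_ : (x - t + 1 <= i < s) = (i < s) && (x - i < t)) //; lia.
Qed.

End NestedProducts.

Section CommutatorFormula.
Variables (R : numFieldType) (W : lmodType R).
Notation vfield := (@vfield R W).
Implicit Types (a b c : vfield) (y : W) (i s t x : int) (K m : nat).

Lemma ad_modes K a b i : local_order K a b ->
  ad a i b = \sum_(m < K) (lexp (- i%:~R) : laurent R) m *: nprod a m b.
Proof.
move=> abK; rewrite ad_resprod; last by exists K.
rewrite /resprod /residue (@zsum_ord _ 0 K) => [|n /orP[hn|hn]].
- by apply: eq_bigr => m _; rewrite add0r.
- by rewrite order_ge_lexp ?scale0r.
- by rewrite (upper_trunc_nprod abK) ?scaler0.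
Qed.

Variables (K : nat) (a b c : vfield) (s t : int) (p : nat -> int -> R).
Hypothesis abK : local_order K a b.
Hypothesis p_antidiff :
  forall m x, p m x - p m (x - 1) = (lexp (- (x - t)%:~R) : laurent R) m.

Lemma ad_window_sum lo hi x y : lo <= hi ->
  \zsum_i (if lo <= i < hi then ad a i b x y else 0) =
  \sum_(m < K) (p m (hi + t - 1) - p m (lo + t - 1)) *: nprod a m b x y.
Proof.
move=> lohi; transitivity (\zsum_i \sum_(m < K)
    (if lo <= i < hi then (lexp (- i%:~R) : laurent R) (Posz m) else 0) *: nprod a m b x y).
  apply: eq_zsum => i; case: ifP => _; last by rewrite big1 // => m _; rewrite scale0r.
  by rewrite (ad_modes _ abK) vcoef_sum.
rewrite (@zsum_sum _ K (fun m i =>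
    (if lo <= i < hi then (lexp (- i%:~R) : laurent R) (Posz m) else 0) *: nprod a m b x y)).
  apply: eq_bigr => m _; rewrite (zsum_morph (fun k l => scalerDl (nprod a m b x y) k l)).
    congr (_ *: _); apply: (zsum_telescope (p := fun i => p m (i + t - 1)) lohi) => i.
    have := p_antidiff m (i + t); rewrite addrK => <-.
    by congr (p _ _ - _); lia.
  exact: bounded_supp_if.
move=> m; apply: (bounded_supp_comp (g := fun k => k *: nprod a m b x y)); first exact: scale0r.
exact: bounded_supp_if.
Qed.

Hypothesis p_root : forall m, p m (s + t - 1) = 0.

Lemma nop_commutator :
  nop a s (nop b t c) - nop b t (nop a s c) =
  \sum_(m < K) nop (weight (p m) (nprod a m b)) (s + t) c.
Proof.
apply: vfieldP => e w; rewrite nop_commutator_coef vcoef_sum.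
under eq_bigr do rewrite nopE.
rewrite -(@zsum_sum _ K (fun m => nop_term (weight (p m) (nprod a m b)) (s + t) c e w));
  last by move=> m; exact: bounded_supp_nop_term.
apply: eq_zsum => x; rewrite /nop_term; have [hx|hx] := leP (s + t) x.
  rewrite [X in _ - X]zsum0 ?subr0 => [|i]; last by rewrite ifF //; lia.
  rewrite ad_window_sum; last by lia.
  by apply: eq_bigr => m _; rewrite p_root subr0 weightE; congr (p m _ *: _); lia.
rewrite zsum0 ?sub0r => [|i]; last by rewrite ifF //; lia.
under eq_zsum do rewrite -[0](linear0 (c (e - x))) -fun_if.
rewrite (zsum_morph (linearD (c (e - x)))); last exact: bounded_supp_if.
rewrite ad_window_sum; last by lia.
rewrite -linearN -sumrN linear_sum; apply: eq_bigr => m _.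
rewrite p_root sub0r scaleNr opprK weightE; congr (c _ (p m _ *: _)); lia.
Qed.

End CommutatorFormula.

Section CommutatorKernels.
Variables (R : numFieldType) (W : lmodType R).
Notation vfield := (@vfield R W).
Implicit Types (a b c d : vfield) (g h : laurent R) (n s t : int) (k : R) (K m : nat).

Definition taylor_coef g h m : laurent R := lconst (m`!%:R)^-1 * lderivn m g * h.

(* Borcherds' commutator formula, paired with [g(z_1) h(z_2)]. *)
Definition commutator_formula g h a b c : Prop := forall K, local_order K a b ->
  resprod g a (resprod h b c) - resprod h b (resprod g a c) =
  \sum_(m < K) resprod (taylor_coef g h m) (nprod a m b) c.

Lemma commutator_formula_lkernel a b c s t : local a b -> local a c -> local b c ->
  commutator_formula (lkernel s%:~R) (lkernel t%:~R) a b c.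
Proof.
move=> ab ac bc K abK.
rewrite -(nop_resprod t bc) -(nop_resprod s ac).
rewrite -(nop_resprod s (local_sym (local_nop t bc (local_sym ab) (local_sym ac)))).
rewrite -(nop_resprod t (local_sym (local_nop s ac ab (local_sym bc)))).
have /choice[p p_antidiff] := fun m =>
  poly_antidifference_root ((m`!%:R)^-1 *: (t%:~R%:P - 'X) ^+ m) (s%:~R + t%:~R - 1 : R).
rewrite (@nop_commutator _ _ K a b c s t (fun m x => (p m).[x%:~R])) //.
- apply: eq_bigr => m _; rewrite nop_weight; last exact: local_nprod.
  by rewrite rmorphD /= (pderiv_lkernel_telescope (p_antidiff m).1 (p_antidiff m).2).
- move=> m x; have /(congr1 (horner^~ x%:~R)) := (p_antidiff m).1.
  rewrite hornerD hornerN horner_comp hornerXsubC hornerZ horner_exp hornerD hornerN.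
  by rewrite hornerC hornerX !rmorphB /= => ->; rewrite lexpE opprB mulrC.
- by move=> m; rewrite rmorphB rmorphD /= (p_antidiff m).2.
Qed.

Lemma taylor_coef_lderivl g h m :
  taylor_coef (lderiv g) h m = lconst m.+1%:R * taylor_coef g h m.+1.
Proof.
rewrite /taylor_coef /lderivn -iterSr factS natrM invfM !mulrA -rmorphM mulVKf //.
by rewrite pnatr_eq0.
Qed.

Lemma lderiv_taylor_coef g h m :
  lderiv (taylor_coef g h m) = taylor_coef (lderiv g) h m + taylor_coef g (lderiv h) m.
Proof. by rewrite /taylor_coef lderivM lderiv_constM -lderivnS /lderivn -iterSr. Qed.

Lemma taylor_coef_continuousl h m d c : local d c ->
  continuous_functional (fun g => resprod (taylor_coef g h m) d c).
Proof.
move=> dc; apply: (continuous_functional_comp (continuous_resprod dc)) => [k g g'|].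
  by rewrite /taylor_coef raddfD /= lderivn_constM; ring.
have [A hA] := laurent_order h; exists (A - m%:Z) => g K hg.
rewrite (_ : K + _ = K - m%:Z + A); last by lia.
exact: order_geM (order_ge_const _ (order_ge_lderivn hg)) hA.
Qed.

Lemma taylor_coef_continuousr g m d c : local d c ->
  continuous_functional (fun h => resprod (taylor_coef g h m) d c).
Proof.
move=> dc; apply: (continuous_functional_comp (continuous_resprod dc)) => [k h h'|].
  by rewrite /taylor_coef; ring.
have [A hA] := laurent_order (lconst (m`!%:R)^-1 * lderivn m g).
by exists A => h K hh; rewrite addrC; exact: order_geM.
Qed.

Lemma resprod_continuousr h a b c : local a b -> local b c -> local a c ->
  continuous_functional (fun g => resprod h a (resprod g b c)).
Proof.
move=> ab bc ac; have bcg g : local a (resprod g b c) by exact: local_resprodr.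
split=> [k g g'|]; first by rewrite resprod_linearl // resprod_linearr.
have [K bcK] := bc; exists K => g gK.
by rewrite (resprod_order_ge bcK gK) resprod0r.
Qed.

Lemma commutator_formula_order_ge a b c g h : local a b -> local a c -> local b c ->
  order_ge (-1) g -> order_ge (-1) h -> commutator_formula g h a b c.
Proof.
move=> ab ac bc hg hh K abK; have ba := local_sym ab.
pose defect g h := resprod g a (resprod h b c) - resprod h b (resprod g a c) -
  \sum_(m < K) resprod (taylor_coef g h m) (nprod a m b) c.
suff : defect g h = 0 by move/eqP; rewrite subr_eq0 => /eqP.
have contl h' : continuous_functional (defect^~ h').
  do ![apply: continuous_functionalB].
  - by apply: continuous_resprod; exact: local_resprodr.
  - exact: resprod_continuousr.
  apply: (@continuous_functional_sum _ _ K
    (fun m g' => resprod (taylor_coef g' h' m) (nprod a m b) c)) => m.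
  by apply: taylor_coef_continuousl; exact: local_nprod.
have contr g' : continuous_functional (defect g').
  do ![apply: continuous_functionalB].
  - exact: resprod_continuousr.
  - by apply: continuous_resprod; exact: local_resprodr.
  apply: (@continuous_functional_sum _ _ K
    (fun m h' => resprod (taylor_coef g' h' m) (nprod a m b) c)) => m.
  by apply: taylor_coef_continuousr; exact: local_nprod.
apply: (functional_lkernel_eq0 (contl h)) hg => s.
apply: (functional_lkernel_eq0 (contr _)) hh => t.
by rewrite /defect (commutator_formula_lkernel s t ab ac bc abK) subrr.
Qed.

Lemma commutator_formula_constl k g h a b c : local a b -> local a c -> local b c ->
  commutator_formula g h a b c -> commutator_formula (lconst k * g) h a b c.
Proof.
move=> ab ac bc gh K abK.
have acZ : resprod (lconst k * g) a c = k *: resprod g a c by rewrite resprodZl.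
rewrite acZ resprodZl ?resprodZr //; try exact: local_resprodr.
  rewrite -scalerBr (gh K abK) scaler_sumr; apply: eq_bigr => m _.
  rewrite -resprodZl; last exact: local_nprod.
  by rewrite /taylor_coef lderivn_constM !mulrA (mulrC (lconst k)).
by apply: local_resprodr => //; exact: local_sym.
Qed.

Lemma commutator_formula_constr k g h a b c : local a b -> local a c -> local b c ->
  commutator_formula g h a b c -> commutator_formula g (lconst k * h) a b c.
Proof.
move=> ab ac bc gh K abK.
have bcZ : resprod (lconst k * h) b c = k *: resprod h b c by rewrite resprodZl.
rewrite bcZ resprodZl ?resprodZr //; try exact: local_resprodr.
  rewrite -scalerBr (gh K abK) scaler_sumr; apply: eq_bigr => m _.
  rewrite -resprodZl; last exact: local_nprod.
  by rewrite /taylor_coef mulrCA.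
by apply: local_resprodr => //; exact: local_sym.
Qed.

Lemma commutator_formula_derivl g h a b c : local a b -> local a c -> local b c ->
  commutator_formula g h (euler a) b c -> commutator_formula (lderiv g) h a b c.
Proof.
move=> ab ac bc gh K abK; have ba := local_sym ab.
have := gh _ (local_order_euler abK); rewrite big_ord_recl.
rewrite nprod_euler // scale0r oppr0 resprod0m add0r.
have bch : local a (resprod h b c) by exact: local_resprodr.
have acg : local b (resprod (lderiv g) a c) by exact: local_resprodr.
rewrite !resprod_euler // resprodNr // -opprD => /(canRL (@opprK _)) ->.
rewrite -sumrN; apply: eq_bigr => m _.
have abm := local_nprod m ab ac bc.
rewrite lift0 nprod_euler // (_ : m.+1%:Z - 1 = m); last by lia.
by rewrite -scaleNr resprodZm // -scaleNr opprK -resprodZl // taylor_coef_lderivl.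
Qed.

Lemma commutator_formula_derivr g h a b c : local a b -> local a c -> local b c ->
  commutator_formula g h a (euler b) c -> commutator_formula g (lderiv h) a b c.
Proof.
move=> ab ac bc gh K abK; have ba := local_sym ab.
have abm n : local (nprod a n b) c by exact: local_nprod.
have ab'K : local_order K.+1 a (euler b).
  exact/local_order_sym/local_order_euler/local_order_sym.
have bch : local a (resprod (lderiv h) b c) by exact: local_resprodr.
have acg : local b (resprod g a c) by exact: local_resprodr.
have := gh _ ab'K; rewrite !resprod_euler // resprodNr // -opprD => /(canRL (@opprK _)) ->.
pose f m := m%:R *: resprod (taylor_coef g h m) (nprod a (m%:Z - 1) b) c.
pose r m := resprod (taylor_coef g (lderiv h) m) (nprod a m b) c.
have fK : f K.+1 = 0.
  rewrite /f (_ : K.+1%:Z - 1 = K); last by lia.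
  by rewrite (upper_trunc_nprod abK) // resprod0m scaler0.
have rK : r K = 0 by rewrite /r (upper_trunc_nprod abK) // resprod0m.
have term m : resprod (taylor_coef g h m) (nprod a m (euler b)) c = - (f m.+1 - f m + r m).
  have -> : nprod a m (euler b) = euler (nprod a m b) + m%:R *: nprod a (m%:Z - 1) b.
    by rewrite euler_nprod // nprod_euler // -pmulrn addrAC addNr add0r.
  rewrite resprodDm ?resprodZm ?resprod_euler //; last first.
  - exact: (submodule_predZ (local_predl c)).
  - exact: local_euler.
  rewrite lderiv_taylor_coef taylor_coef_lderivl resprodDl // resprodZl //.
  rewrite /f /r (_ : m.+1%:Z - 1 = m); last by lia.
  by rewrite [in RHS]addrAC opprB [RHS]addrC.
under eq_bigr => m _ do rewrite term.
rewrite -sumrN; under eq_bigr => m _ do rewrite opprK.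
rewrite big_split /= -(big_mkord xpredT (fun m => f m.+1 - f m)) telescope_sumr //.
by rewrite fK /f scale0r subr0 add0r big_ord_recr /= rK addr0.
Qed.

Lemma lmon_ind (P : laurent R -> Prop) : (forall n, -1 <= n -> P (lmon n)) ->
  (forall k g, P g -> P (lconst k * g)) -> (forall g, P g -> P (lderiv g)) ->
  forall n, P (lmon n).
Proof.
move=> P0 PZ PD; suff down (N : nat) n : -1 - N%:Z <= n -> P (lmon n).
  by move=> n; apply: (down (absz n)); lia.
elim: N n => [|N IH] n hn; first by apply: P0; lia.
have [/IH //|hn'] := leP (-1 - N%:Z) n.
have n1 : (n + 1)%:~R != 0 :> R by rewrite intr_eq0; lia.
have -> : lmon n = lconst (n + 1)%:~R^-1 * lderiv (lmon (n + 1)) :> laurent R.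
  by rewrite lderiv_mon addrK mulrA -rmorphM mulVf // rmorph1 mul1r.
by apply/PZ/PD/IH; lia.
Qed.

Lemma commutator_formula_lmon a b c n s : local a b -> local a c -> local b c ->
  commutator_formula (lmon n) (lmon s) a b c.
Proof.
pose holds g h := forall a b c, local a b -> local a c -> local b c ->
  commutator_formula g h a b c.
suff : holds (lmon n) (lmon s) by exact.
have pole n' : -1 <= n' -> order_ge (-1) (lmon n' : laurent R).
  by move=> hn; apply: order_geW hn _; exact: order_ge_mon.
apply: (lmon_ind (P := holds^~ (lmon s))) => {n} [n hn|k g gs|g gs] {}a {}b {}c ab ac bc.
- apply: (lmon_ind (P := holds (lmon n))) ab ac bc => {s} [s hs|k h nh|h nh] {}a {}b {}c ab ac bc.
  + by apply: commutator_formula_order_ge => //; exact: pole.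
  + by apply: commutator_formula_constr => //; exact: nh.
  + apply: commutator_formula_derivr => //; apply: nh => //; last exact: local_euler.
    exact/local_sym/local_euler/local_sym.
- by apply: commutator_formula_constl => //; exact: gs.
- by apply: commutator_formula_derivl => //; apply: gs => //; exact: local_euler.
Qed.

Definition binz n m : R := (\prod_(j < m) (n%:~R - j%:R)) / (m`!)%:R.

Lemma binz0 n : binz n 0 = 1.
Proof. by rewrite /binz big_ord0 divr1. Qed.

Lemma binz1 n : binz n 1 = n%:~R.
Proof. by rewrite /binz big_ord1 subr0 divr1. Qed.

Theorem nprod_commutator K a b c n s : local_order K a b -> local a c -> local b c ->
  nprod a n (nprod b s c) - nprod b s (nprod a n c) =
  \sum_(m < K) binz n m *: nprod (nprod a m b) (n + s - m%:Z) c.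
Proof.
move=> abK ac bc; have ab : local a b by exists K.
have := commutator_formula_lmon n s ab ac bc abK.
rewrite !resprod_mon => ->; apply: eq_bigr => m _.
have abm : local (nprod a m b) c by exact: local_nprod.
rewrite -(resprod_mon (n + s - m%:Z)) -resprodZl // (addrAC n) lmonD.
by rewrite /taylor_coef lderivn_mon /binz rmorphM /= !mulrA (mulrC (lconst _^-1)).
Qed.

End CommutatorKernels.

(** * Associativity *)

Section BinomialDifferences.
Variables (R : numFieldType) (W : lmodType R).
Implicit Types (F : int -> int -> W) (u : int -> W) (k : nat).

Definition sign_binom k (l : nat) : R := 'C(k, l)%:R * (-1) ^+ (k - l).

Lemma sign_binomS k l : (l <= k)%N -> sign_binom k.+1 l.+1 = sign_binom k l - sign_binom k l.+1.
Proof.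
move=> lk; rewrite /sign_binom binS subSS natrD mulrDl addrC; congr (_ + _).
move: lk; rewrite leq_eqVlt => /orP[/eqP ->|lk]; first by rewrite bin_small // !mul0r oppr0.
by rewrite -(subnSK lk) exprS mulN1r mulrN.
Qed.

Lemma sign_binomS0 k : sign_binom k.+1 0 = - sign_binom k 0.
Proof. by rewrite /sign_binom !bin0 !subn0 exprS !mul1r mulN1r. Qed.

Lemma iter_diff_binomial k u (p : int) :
  iter k (@diff W) u (p - k%:Z) = \sum_(l < k.+1) sign_binom k l *: u (p - l%:Z).
Proof.
elim: k p => [|k IH] p; first by rewrite big_ord1 /sign_binom bin0 mulr1 scale1r.
rewrite iterS diffE (_ : p - k.+1%:Z = p - 1 - k%:Z); last by lia.
rewrite (_ : p - 1 - k%:Z + 1 = p - k%:Z) ?IH; last by lia.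
have extend : \sum_(l < k.+1) sign_binom k l *: u (p - l%:Z) =
    \sum_(l < k.+2) sign_binom k l *: u (p - l%:Z).
  by rewrite [RHS]big_ord_recr /= /sign_binom bin_small // mul0r scale0r addr0.
rewrite extend [X in _ - X]big_ord_recl [RHS]big_ord_recl opprD addrCA -scaleNr sign_binomS0.
congr (_ + _); rewrite -sumrB; apply: eq_bigr => -[l hl] _.
rewrite !lift0 /= sign_binomS // scalerBl; congr (_ *: u _ - _); lia.
Qed.

(* The coefficient of [x_1^p x_2^q] in [(x_1 - x_2)^k F(x_1, x_2)]. *)
Definition xsub_pow k F (p q : int) : W :=
  \sum_(l < k.+1) sign_binom k l *: F (p - l%:Z) (q - k%:Z + l%:Z).

Definition leps : laurent R := lexp 1 - 1.

Lemma order_ge_leps : order_ge 1 leps.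
Proof. by case=> [[|n]|n] // _; rewrite lcoefB lcoef1 ?lexp_coef0 ?order_ge_lexp ?subrr. Qed.

Lemma lead_coef_leps : leps 1 = 1.
Proof. by rewrite lcoefB lexp_coef1 lcoef1 subr0. Qed.

Lemma leps_exp k :
  leps ^+ k = \sum_(l < k.+1) lconst (sign_binom k l) * lexp l%:R.
Proof.
rewrite /leps addrC exprDn; apply: eq_bigr => l _.
by rewrite lexp_natX /sign_binom rmorphM rmorphXn rmorphN rmorph1 rmorph_nat -mulr_natl mulrA.
Qed.

Lemma residue_window (y : int -> W) (M q : int) (p : nat) : upper_trunc M y ->
  \sum_(j < absz (q + M + 1) | j%:Z < q + M + 1)
     ((j`!%:R)^-1 * p%:R ^+ j) *: y (j%:Z - q - 1) =
  residue (lmon (- q - 1) * lexp p%:R) y.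
Proof.
move=> yM; have hX : order_ge (- q - 1) (lmon (- q - 1) * lexp p%:R : laurent R).
  by move=> n hn; rewrite lcoef_mon order_ge_lexp //; lia.
have [win_ge0|win_lt0] := leP 0 (q + M + 1); last first.
  rewrite big_pred0 => [|j]; last by lia.
  by rewrite (residue_order_ge yM) //; apply: order_geW hX; lia.
rewrite /residue (@zsum_ord _ (- q - 1) (absz (q + M + 1)%R)) => [|n /orP[hn|hn]]; last 2 first.
- by rewrite hX ?scale0r.
- by rewrite yM ?scaler0 //; lia.
rewrite big_mkcond; apply: eq_bigr => -[j hj] _ /=; rewrite ifT; last by lia.
rewrite lcoef_mon (_ : - q - 1 + j%:Z - (- q - 1) = j); last by lia.
by rewrite lexpE mulrC (_ : - q - 1 + j%:Z = j%:Z - q - 1) //; lia.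
Qed.

Lemma residue_leps_window k (y : int -> W) (M q : int) : upper_trunc M y ->
  \sum_(l < k.+1) sign_binom k l *:
   \sum_(j < absz (q + M + 1) | j%:Z < q + M + 1)
     ((j`!%:R)^-1 * l%:R ^+ j) *: y (j%:Z - q - 1) =
  residue (lmon (- q - 1) * leps ^+ k) y.
Proof.
move=> yM; rewrite leps_exp mulr_sumr (residue_suml _ _ yM); apply: eq_bigr => l _.
by rewrite (residue_window _ _ yM) mulrCA [RHS](residueZl _ _ yM).
Qed.

Lemma order_ge_lmonM_leps q k : order_ge (q + k%:Z) (lmon q * leps ^+ k).
Proof.
rewrite -[k%:Z]mulr1; apply: order_geM; first exact: order_ge_mon.
exact: order_ge_exp order_ge_leps.
Qed.

Lemma lead_coef_lmonM_leps q k : (lmon q * leps ^+ k) (q + k%:Z) = 1.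
Proof.
rewrite lcoef_mon addrAC subrr add0r -[k%:Z]mulr1.
by rewrite (lead_coef_exp k order_ge_leps) lead_coef_leps expr1n.
Qed.

Lemma residue_leps_inj k (y : int -> W) (M : int) : upper_trunc M y ->
  (forall q, residue (lmon (- q - 1) * leps ^+ k) y = 0) -> forall n, y n = 0.
Proof.
move=> yM res0 n; apply: (residue_triangular_eq0 (A := n) yM) (lexx n) => i _.
pose q := k%:Z - i - 1; have iE : i = - q - 1 + k%:Z by rewrite /q; lia.
exists (lmon (- q - 1) * leps ^+ k); split; last exact: res0.
- by rewrite iE; exact: order_ge_lmonM_leps.
by rewrite iE; exact: lead_coef_lmonM_leps.
Qed.

End BinomialDifferences.

Section SubstitutionKernel.
Variable R : numFieldType.

Definition subst_kernel (k q : nat) : laurent R :=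
  lconst (q`!%:R)^-1 * \sum_(l < k.+1) lconst (sign_binom R k l) *
    pderiv (lkernel (- l%:R)) (('X + l%:R%:P) ^+ q).

Lemma lmon_lderivn (q : nat) :
  lmon (- q%:Z - 1) = lconst ((-1) ^+ q / q`!%:R) * lderivn q (lmon (-1)) :> laurent R.
Proof.
have falling : \prod_(j < q) ((-1)%:~R - j%:R) = (-1) ^+ q * q`!%:R :> R.
  elim: q => [|q IH]; first by rewrite big_ord0 mul1r.
  by rewrite big_ord_recr /= IH factS natrM exprS -natr1 rmorphN1; ring.
rewrite lderivn_mon mulrA -rmorphM falling (_ : -1 - q%:Z = - q%:Z - 1); last by lia.
by rewrite mulrACA -expr2 sqrr_sign mul1r mulVf ?natr_fact_neq0 // rmorph1 mul1r.
Qed.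

Lemma subst_kernelE k q :
  subst_kernel k q = lconst ((-1) ^+ q / q`!%:R) * (leps R ^+ k * lderivn q lkappa).
Proof.
rewrite /subst_kernel leps_exp [(-1) ^+ q / _]mulrC rmorphM /= -mulrA; congr (_ * _).
rewrite mulrA mulr_sumr mulr_suml; apply: eq_bigr => l _.
have -> : ('X + l%:R%:P) ^+ q = (-1) ^+ q *: ((- l%:R)%:P - 'X) ^+ q :> {poly R}.
  by rewrite -mul_polyC rmorphXn -exprMn !polyCN; congr (_ ^+ _); ring.
by rewrite pderivZ pderiv_subX_exp /lkernel opprK lexpK; ring.
Qed.

(* [z^-1] differs from [kappa] by a power series, which multiplication by [(e^z - 1)^k]
   moves to order [k]. *)
Lemma order_ge_subst_kernel k q :
  order_ge k%:Z (lmon (- q%:Z - 1) * leps R ^+ k - subst_kernel k q).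
Proof.
rewrite lmon_lderivn subst_kernelE -!mulrA -mulrBr [lderivn q _ * _]mulrC -mulrBr -raddfB.
apply: order_ge_const; rewrite -[k%:Z]mulr1 -[_ * 1]addr0.
apply: order_geM (order_ge_exp (@order_ge_leps R)) _; apply: order_ge_lderivn0.
move=> n hn; rewrite lcoefB lmonE; have [->|n1] := eqVneq n (-1).
  by rewrite lead_coef_lkappa subrr.
by rewrite order_ge_lkappa ?subrr //; lia.
Qed.

End SubstitutionKernel.

Section Associativity.
Variables (R : numFieldType) (W : lmodType R).
Notation vfield := (@vfield R W).
Implicit Types (a c : vfield) (w : W) (e n p t : int) (k : nat).

Lemma iter_diff_ad k a c w (p p' : int) :
  iter k (@diff _) (fun t => ad a t c) (p - k%:Z) (p + p' - k%:Z) w =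
  xsub_pow k (fun i j => a i (c j w)) p p' - xsub_pow k (fun i j => c j (a i w)) p p'.
Proof.
rewrite iter_diff_binomial vcoef_sum -sumrB; apply: eq_bigr => l _.
rewrite -scalerBr vcoefZ adE; congr (_ *: _).
by rewrite (_ : p + p' - k%:Z - (p - l%:Z) = p' - k%:Z + l%:Z) //; lia.
Qed.

Lemma local_order_xsub_pow k a c w (p p' : int) : local_order k a c ->
  xsub_pow k (fun i j => a i (c j w)) p p' = xsub_pow k (fun i j => c j (a i w)) p p'.
Proof. by move=> acK; apply/eqP; rewrite -subr_eq0 -iter_diff_ad acK. Qed.

Lemma local_order_of_trunc k a c : local a c ->
  (forall w, exists N : int, forall p p', p < N ->
     xsub_pow k (fun i j => a i (c j w)) p p' = 0) -> local_order k a c.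
Proof.
move=> [K acK] trunc; apply/degree_lt_vcoefP => e w.
have [N hN] := trunc w; have [A hA] := vcoef_trunc a w.
have /(degree_lt_iter k) coefK := (degree_lt_vcoefP _ _).1 acK e w.
suff top0 : iter k (@diff _) (fun t => ad a t c e w) = fun=> 0 by move=> t; rewrite top0.
apply: (degree_lt_order_ge_eq0 (A := Num.min N A - k%:Z) coefK) => t ht.
rewrite -iter_diff_vcoef (_ : t = t + k%:Z - k%:Z); last by lia.
rewrite (_ : e = t + k%:Z + (e - t) - k%:Z); last by lia.
rewrite iter_diff_ad hN ?sub0r; last by lia.
rewrite /xsub_pow big1 ?oppr0 // => l _; rewrite hA ?linear0 ?scaler0 //; lia.
Qed.

Lemma resprod_leps_lt0 k a c (q : int) : local_order k a c -> q < 0 ->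
  resprod (lmon (- q - 1) * leps R ^+ k) a c = 0.
Proof.
move=> acK q0; apply: (resprod_order_ge acK).
apply: (order_geW _ (@order_ge_lmonM_leps R (- q - 1) k)); lia.
Qed.

Lemma resprod_leps k a c (q : nat) : local_order k a c ->
  resprod (lmon (- q%:Z - 1) * leps R ^+ k) a c =
  (q`!%:R)^-1 *: \sum_(l < k.+1) sign_binom R k l *:
     nop (weight (fun n => (n + l%:Z)%:~R ^+ q) a) (- l%:Z) c.
Proof.
move=> acK; have ac : local a c by exists k.
transitivity (resprod (subst_kernel R k q) a c).
  apply/eqP; rewrite -subr_eq0 -resprodBl //; apply/eqP.
  exact: (resprod_order_ge acK (@order_ge_subst_kernel R k q)).
rewrite resprodZl // resprod_suml //; congr (_ *: _); apply: eq_bigr => l _.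
rewrite resprodZl //; congr (_ *: _).
have -> : weight (fun n => (n + l%:Z)%:~R ^+ q) a =
    weight (fun n => (('X + l%:R%:P) ^+ q).[n%:~R]) a.
  by apply: vfieldP => n w; rewrite !weightE horner_exp hornerD hornerX hornerC rmorphD.
by rewrite nop_weight // mulrNz -pmulrn.
Qed.

Lemma resprod_leps_subst k a c (q : nat) (e : int) w : local_order k a c ->
  resprod (lmon (- q%:Z - 1) * leps R ^+ k) a c (e - k%:Z) w =
  (q`!%:R)^-1 *: \zsum_p (p%:~R ^+ q *: xsub_pow k (fun i j => a i (c j w)) p (e - p)).
Proof.
move=> acK; rewrite resprod_leps // vcoefZ vcoef_sum; congr (_ *: _).
pose G (l : nat) (p : int) : W := sign_binom R k l *:
  nop_term (weight (fun n => (n + l%:Z)%:~R ^+ q) a) (- l%:Z) c (e - k%:Z) w (p - l%:Z).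
have Gfin l : bounded_supp (G l).
  exact/bounded_suppZ/(bounded_supp_shift (- l%:Z) (bounded_supp_nop_term _ _ _ _ _)).
transitivity (\sum_(l < k.+1) zsum (G l)).
  apply: eq_bigr => l _; rewrite vcoefZ nopE zsumZ ?zsum_shift //.
  exact: (bounded_supp_shift (- l%:Z) (bounded_supp_nop_term _ _ _ _ _)).
rewrite -zsum_sum //; apply: eq_zsum => p.
have [hp|hp] := leP 0 p; last rewrite local_order_xsub_pow //.
all: rewrite /xsub_pow scaler_sumr; apply: eq_bigr => l _; rewrite /G /nop_term !weightE subrK.
all: rewrite (_ : e - k%:Z - (p - l%:Z) = e - p - k%:Z + l%:Z); last by lia.
  rewrite (_ : (- l%:Z <= p - l%:Z) = true); last by lia.
  by rewrite !scalerA mulrC.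
rewrite (_ : (- l%:Z <= p - l%:Z) = false); last by lia.
by rewrite linearZ /= !scalerA mulrC.
Qed.

End Associativity.

(** * Vertex algebras and the vacuum module *)

Section Submodules.
Variables (R : pzRingType) (U : lmodType R) (P : U -> Prop).

Definition submodule_carrier (hP : submodule_pred P) : {pred U} := [pred x | `[< P x >]].

Lemma submodule_carrier_closed hP : submod_closed (submodule_carrier hP).
Proof.
split=> [|k x y /asboolP Px /asboolP Py]; apply/asboolP; first exact: hP.1.
exact: hP.2.
Qed.
HB.instance Definition _ hP :=
  GRing.isSubmodClosed.Build R U (submodule_carrier hP) (submodule_carrier_closed hP).

Record submodule (hP : submodule_pred P) :=
  Submodule { submodule_val :> U; submodule_valP : submodule_val \in submodule_carrier hP }.

HB.instance Definition _ hP := [isSub for @submodule_val hP].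
HB.instance Definition _ hP := [Choice of submodule hP by <:].
HB.instance Definition _ hP := [SubChoice_isSubLmodule of submodule hP by <:].

Variable hP : submodule_pred P.
Implicit Types x y : submodule hP.

Definition to_submodule (u : U) (Pu : P u) : submodule hP := Submodule (asboolT Pu).

Lemma submodule_pred_val x : P x. Proof. exact/asboolP/submodule_valP. Qed.

Lemma submodule_val_inj x y : x = y :> U -> x = y. Proof. exact: val_inj. Qed.

Lemma submodule_val_linear k x y : (k *: x + y : submodule hP) = k *: (x : U) + (y : U) :> U.
Proof. by []. Qed.

Lemma submodule_valB x y : (x - y : submodule hP) = (x : U) - (y : U) :> U.
Proof. exact: (raddfB val). Qed.

End Submodules.

Section LinearMaps.
Variables (U V : lmodType C) (f : U -> V) (hf : islin f).

Let f_linear : {linear U -> V} := HB.pack f (GRing.isLinear.Build C U V *:%R f hf).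

Lemma islin0 : f 0 = 0. Proof. exact: (linear0 f_linear). Qed.
Lemma islinN x : f (- x) = - f x. Proof. exact: (linearN f_linear). Qed.
Lemma islinZ k x : f (k *: x) = k *: f x. Proof. exact: (linearZ_LR f_linear). Qed.
Lemma islinB x y : f (x - y) = f x - f y. Proof. exact: (linearB f_linear). Qed.
Lemma islin_sum n (F : 'I_n -> U) : f (\sum_(i < n) F i) = \sum_(i < n) f (F i).
Proof. exact: (linear_sum f_linear). Qed.

End LinearMaps.

Definition generator_action (V : Type) (TV EV : int -> int -> V -> V) (i : bool * int) :
  int -> V -> V := if i.1 then TV i.2 else EV i.2.

Section VacuumModule.
Variables (l1 l2 l3 l4 : C) (V : lmodType C) (TV EV : int -> int -> V -> V) (vac : V).
Hypothesis HV : vacuum_module l1 l2 l3 l4 TV EV vac.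

(* The universal property maps [V] into the submodule cut out by [P]; by uniqueness the
   composite with the inclusion is the identity. *)
Lemma vacuum_module_ind (P : V -> Prop) : submodule_pred P -> P vac ->
  (forall i n v, P v -> P (generator_action TV EV i n v)) -> forall v, P v.
Proof.
move=> hP Pvac Pact; have [hM [vac0 univ]] := HV.
have [T_lin [E_lin [TT [TE EE]]]] := hM.
pose TS m n (x : submodule hP) : submodule hP :=
  to_submodule hP (Pact (true, m) n _ (submodule_pred_val x)).
pose ES m n (x : submodule hP) : submodule hP :=
  to_submodule hP (Pact (false, m) n _ (submodule_pred_val x)).
have subL : Lhat_module l1 l2 l3 l4 TS ES.
  do !split.
  - by move=> m n k x y; apply: submodule_val_inj; exact: T_lin.
  - by move=> m n k x y; apply: submodule_val_inj; exact: E_lin.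
  - by move=> m n r s x; apply: submodule_val_inj; rewrite submodule_valB; exact: TT.
  - by move=> m n r s x; apply: submodule_val_inj; rewrite submodule_valB; exact: TE.
  - by move=> m n r s x; apply: submodule_val_inj; rewrite submodule_valB; exact: EE.
have sub0 : nonneg_annihilated TS ES (to_submodule hP Pvac).
  by move=> m n hn; have [T0 E0] := vac0 m n hn; split; apply: submodule_val_inj.
have [[f [f_lin [f_vac [fT fE]]]] _] := univ _ _ _ _ subL sub0.
have [_ uniq] := univ V TV EV vac hM vac0.
move=> v; suff <- : f v = v :> V by exact: submodule_pred_val.
apply: (uniq (fun v => f v : V) id) => //.
- by move=> k x y; rewrite f_lin.
- by rewrite f_vac.
- by move=> m n x; rewrite fT.
- by move=> m n x; rewrite fE.
Qed.

End VacuumModule.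

Section VertexAlgebra.
Variables (V : lmodType C) (vac : V) (YV : V -> int -> V -> V).
Hypothesis HVA : vertex_algebra vac YV.
Implicit Types (a u v w : V) (p q r : int).

Lemma YV_linearl n v : islin (fun u => YV u n v).
Proof. by case: HVA. Qed.

Lemma YV_linearr u n : islin (YV u n).
Proof. by case: HVA => _ []. Qed.

Lemma YV_trunc u v : exists N : int, upper_trunc N (fun n => YV u n v).
Proof. by case: HVA => _ [_ [h _]]; exact: h. Qed.

Lemma YV_vacl n v : YV vac n v = if n == -1 then v else 0.
Proof. by case: HVA => _ [_ [_ [h _]]]; exact: h. Qed.

Lemma YV_vacr_ge0 u n : 0 <= n -> YV u n vac = 0.
Proof. by case: HVA => _ [_ [_ [_ [h _]]]]; exact: h. Qed.

Lemma YV_vacr_creation u : YV u (-1) vac = u.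
Proof. by case: HVA => _ [_ [_ [_ [_ [h _]]]]]; exact: h. Qed.

Lemma borcherds_identity u v w p q r : exists N0 : nat, forall N : nat, (N0 <= N)%N ->
  \sum_(i < N) zbinom p i *: YV (YV u (r + i%:Z) v) (p + q - i%:Z) w =
  \sum_(i < N) ((-1) ^+ i * zbinom r i) *:
    (YV u (p + r - i%:Z) (YV v (q + i%:Z) w)
     - (-1) ^ r *: YV v (q + r - i%:Z) (YV u (p + i%:Z) w)).
Proof.
have [A uvA] := YV_trunc u v; have [B vwB] := YV_trunc v w; have [D uwD] := YV_trunc u w.
exists (absz (A - r)%R + absz (B - q)%R + absz (D - p)%R)%N => N hN.
case: HVA => _ [_ [_ [_ [_ [_]]]]]; apply=> i hi.
by rewrite uvA ?vwB ?uwD //; lia.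
Qed.

Lemma zbinomS0 i : zbinom 0 i.+1 = 0.
Proof. by rewrite /zbinom big_ord_recl /= subrr !mul0r. Qed.

Lemma zbinom0 p : zbinom p 0 = 1.
Proof. exact: (binz0 C p). Qed.

Lemma zbinom1 p : zbinom p 1 = p%:~R.
Proof. exact: (binz1 C p). Qed.

Lemma YV_commutator u v w p q : exists N0 : nat, forall N : nat, (N0 <= N)%N ->
  YV u p (YV v q w) - YV v q (YV u p w) =
  \sum_(i < N) zbinom p i *: YV (YV u i v) (p + q - i%:Z) w.
Proof.
have [N0 borcherds] := borcherds_identity u v w p q 0; exists N0.+1 => N hN.
have := borcherds N (ltnW hN); under eq_bigr do rewrite add0r; move=> ->.
case: N hN => // N _; rewrite big_ord_recl expr0 mul1r zbinom0 scale1r big1 => [|i _].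
  by rewrite /= !addr0 ?subr0 expr0z scale1r.
by rewrite zbinomS0 mulr0 scale0r.
Qed.

Lemma YV_translation a u r :
  YV (YV a r u) (-2) vac = YV a r (YV u (-2) vac) - r%:~R *: YV a (r - 1) u.
Proof.
have [N0 borcherds] := borcherds_identity a u vac 0 (-2) r.
have := borcherds N0.+2 (leqW (leqnSn N0)).
rewrite big_ord_recl zbinom0 scale1r big1 => [|i _]; last by rewrite zbinomS0 scale0r.
rewrite addr0 subr0 add0r addr0 => ->.
have a0 (i : nat) : YV a i vac = 0 by exact: YV_vacr_ge0.
rewrite big_ord_recl big_ord_recl big1 => [|i _].
  rewrite /= !(add0r, addr0, subr0) expr0 expr1 zbinom0 zbinom1 mul1r scale1r !a0.
  rewrite !(islin0 (YV_linearr _ _)) !scaler0 !subr0 mulN1r scaleNr.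
  by rewrite (_ : -2 + 1%:Z = -1) // YV_vacr_creation.
rewrite !lift0 (YV_vacr_ge0 u); last by lia.
by rewrite add0r a0 !(islin0 (YV_linearr _ _)) scaler0 subr0 scaler0.
Qed.

(* In Borcherds' identity for [u], [vac], [w] with [q = 0] and [r = -2] all modes of the vacuum
   on the right vanish. *)
Lemma YV_translation_mode u q w : YV (YV u (-2) vac) q w = - (q%:~R *: YV u (q - 1) w).
Proof.
have [N0 borcherds] := borcherds_identity u vac w q 0 (-2).
have := borcherds N0.+2 (leqW (leqnSn N0)); rewrite [X in _ = X]big1 => [|i _]; last first.
  rewrite !YV_vacl ifF ?ifF; try lia.
  by rewrite (islin0 (YV_linearr _ _)) scaler0 subr0 scaler0.
rewrite !big_ord_recl big1 => [|i _]; last first.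
  rewrite !lift0 (YV_vacr_ge0 u); last by lia.
  by rewrite (islin0 (YV_linearl _ _)) scaler0.
rewrite /= zbinom0 zbinom1 scale1r !addr0 (_ : -2 + 1%:Z = -1) // YV_vacr_creation.
by move/eqP; rewrite addr_eq0 => /eqP.
Qed.

End VertexAlgebra.

(** * Coordinated modules *)

Lemma subst_coefE (W : lmodType C) (F : int -> int -> W) (N c : int) (q : nat) :
  (forall a b, (a < N) || (b < N) -> F a b = 0) ->
  subst_coef F N c q = (q`!%:R)^-1 *: \zsum_p (p%:~R ^+ q *: F p (c - p)).
Proof.
move=> F0; rewrite /subst_coef; congr (_ *: _).
have [win_ge0|win_lt0] := leP 0 (c - 2 * N + 1); last first.
  rewrite big_pred0 => [|i]; last by lia.
  by rewrite zsum0 // => p; rewrite F0 ?scaler0 //; lia.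
rewrite (@zsum_ord _ N (absz (c - 2 * N + 1)%R)) => [|p hp]; last first.
  by rewrite F0 ?scaler0 //; lia.
rewrite big_mkcond; apply: eq_bigr => -[i hi] _ /=; rewrite ifT; last by lia.
by rewrite (_ : c - N - i%:Z = c - (N + i%:Z)) //; lia.
Qed.

Lemma assoc_coefE (V W : lmodType C) (YV : V -> int -> V -> V) (YW : V -> int -> W -> W)
    k u v w (M c q : int) :
  (forall n, islin (fun x => YW x n w)) -> upper_trunc M (fun n => YV u n v) ->
  assoc_coef YV YW k u v w M c q =
  residue (lmon (- q - 1) * leps C ^+ k) (fun n => YW (YV u n v) (c - k%:Z) w).
Proof.
move=> YW_lin uvM; rewrite -(@residue_leps_window _ _ _ _ M) // => n hn.
by rewrite uvM // (islin0 (YW_lin _)).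
Qed.

Section GeneratedModule.
Variables (V : lmodType C) (vac : V) (YV : V -> int -> V -> V) (I : Type) (gen : I -> V).
Hypothesis HVA : vertex_algebra vac YV.
Hypothesis gen_ind : forall P : V -> Prop, submodule_pred P -> P vac ->
  (forall i n v, P v -> P (YV (gen i) n v)) -> forall v, P v.

Variables (W : lmodType C) (G : I -> @vfield C W) (Y : V -> @vfield C W).
Hypothesis Y_lin : islin Y.
Hypothesis Y_vac : Y vac = id_field.
Hypothesis Y_action : forall i n v, Y (YV (gen i) n v) = nprod (G i) n (Y v).
Hypothesis G_local : forall i v, local (G i) (Y v).
Implicit Types (u v : V) (w : W) (n : int).

Lemma Y_gen i : Y (gen i) = G i.
Proof. by rewrite -(YV_vacr_creation HVA (gen i)) Y_action Y_vac nprodN1_id. Qed.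

Lemma submodule_pred_Y (P : @vfield C W -> Prop) :
  submodule_pred P -> submodule_pred (fun v => P (Y v)).
Proof.
by move=> [P0 PL]; split=> [|k x y Px Py]; rewrite ?(islin0 Y_lin) // Y_lin; exact: PL.
Qed.

Lemma Y_local u v : local (Y u) (Y v).
Proof.
apply: (gen_ind (P := fun v => local (Y u) (Y v))) => {v} [||i n v uv].
- exact/submodule_pred_Y/local_predr.
- by rewrite Y_vac; exact: local_id.
by rewrite Y_action; apply: local_nprodr => //; exact/local_sym.
Qed.

Lemma Y_translation u : Y (YV u (-2) vac) = euler (Y u).
Proof.
apply: (gen_ind (P := fun u => Y (YV u (-2) vac) = euler (Y u))) => {u} [||i n u hu].
- split=> [|k x y hx hy]; first by rewrite (islin0 (YV_linearl HVA _ _)) (islin0 Y_lin) linear0.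
  by rewrite (YV_linearl HVA (-2) vac) !Y_lin hx hy linearP.
- by rewrite (YV_vacl HVA) (islin0 Y_lin) Y_vac euler_id.
rewrite (YV_translation HVA) (islinB Y_lin) (islinZ Y_lin) !Y_action hu.
by rewrite euler_nprod // nprod_euler // addrC.
Qed.

Lemma Y_nprod_vac u n : Y (YV u n vac) = nprod (Y u) n id_field.
Proof.
case: n => [n|j]; first by rewrite (YV_vacr_ge0 HVA) // (islin0 Y_lin) nprod_id.
elim: j u => [|j IH] u; first by rewrite (YV_vacr_creation HVA) (nprodN1_id (Y u)).
have := IH (YV u (-2) vac).
rewrite Y_translation (YV_translation_mode HVA) (nprod_euler _ (local_id _)).
rewrite (islinN Y_lin) (islinZ Y_lin) (_ : Negz j - 1 = Negz j.+1); last by lia.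
by move=> /oppr_inj; apply: scalerI; rewrite intr_eq0.
Qed.

(* Both sides obey the same commutator formula with the generators, which moves [u_n] past
   [(gen i)_s]. *)
Lemma Y_nprod u n v : Y (YV u n v) = nprod (Y u) n (Y v).
Proof.
move: u n; apply: (gen_ind (P := fun v => forall u n, Y (YV u n v) = nprod (Y u) n (Y v)))
  => {v} [||i s v hv].
- split=> [u n|k x y hx hy u n].
    by rewrite (islin0 (YV_linearr HVA _ _)) (islin0 Y_lin) nprod0r.
  by rewrite (YV_linearr HVA) !Y_lin hx hy (nprod_linearr _ _ (Y_local _ _) (Y_local _ _)).
- by rewrite Y_vac; exact: Y_nprod_vac.
move=> u n; have [N YV_comm] := YV_commutator HVA (gen i) u v s n.
have [K GuK] := G_local i u.
have := nprod_commutator s n (local_orderW (leq_maxr N K) GuK) (G_local i v) (Y_local u v).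
have := congr1 Y (YV_comm _ (leq_maxl N K)).
rewrite (islinB Y_lin) (islin_sum Y_lin) Y_action hv.
under eq_bigr => m _ do rewrite (islinZ Y_lin) hv Y_action.
by move=> <- /addrI/oppr_inj <-; rewrite Y_action.
Qed.

Notation YW := (fun v n w => Y v n w).

Lemma YW_lin n w : islin (fun v => YW v n w).
Proof. by move=> k x y; rewrite Y_lin. Qed.

Lemma prod_coefE k u v w : prod_coef YW k u v w = xsub_pow k (fun i j => Y u i (Y v j w)).
Proof. by []. Qed.

Lemma prod_coef_trunc k u v w : local_order k (Y u) (Y v) ->
  exists N : int, forall a b, (a < N) || (b < N) -> prod_coef YW k u v w a b = 0.
Proof.
move=> uvk; have [A hA] := vcoef_trunc (Y u) w; have [B hB] := vcoef_trunc (Y v) w.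
exists (Num.min A B) => a b; rewrite prod_coefE.
have [bB _|bB abN] := ltP b B.
  by rewrite /xsub_pow big1 // => -[l hl] _; rewrite hB ?linear0 ?scaler0 //=; lia.
rewrite local_order_xsub_pow // /xsub_pow big1 // => -[l hl] _.
by rewrite hA ?linear0 ?scaler0 //=; lia.
Qed.

Lemma Y_associativity k u v w (N M c q : int) : local_order k (Y u) (Y v) ->
  (forall a b, (a < N) || (b < N) -> prod_coef YW k u v w a b = 0) ->
  upper_trunc M (fun n => YV u n v) ->
  assoc_coef YV YW k u v w M c q =
  if q < 0 then 0 else subst_coef (prod_coef YW k u v w) N c (absz q).
Proof.
move=> uvk hN uvM; rewrite (assoc_coefE _ _ _ (YW_lin^~ w) uvM).
under [X in residue _ X]eq_fun do rewrite Y_nprod.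
have uv : local (Y u) (Y v) by exists k.
rewrite -resprod_eval //; case: (ltP q 0) => hq; first by rewrite resprod_leps_lt0.
by rewrite (subst_coefE _ _ hN); case: q hq => // q _; rewrite resprod_leps_subst.
Qed.

Theorem Y_phi_coordinated : phi_coordinated_module vac YV YW.
Proof.
split; first exact: YW_lin.
split; first by move=> v n k x y; exact: linearP.
split; first by move=> v w; exact: vcoef_trunc.
split; first by move=> n w; rewrite Y_vac id_fieldE.
move=> u v; have [k uvk] := Y_local u v; exists k => w.
have [N hN] := prod_coef_trunc w uvk; exists N; split=> // M uvM c q.
exact: Y_associativity.
Qed.

Section Uniqueness.
Variable Y' : V -> int -> W -> W.
Hypothesis Y'_module : phi_coordinated_module vac YV Y'.
Hypothesis Y'_gen : forall i n w, Y' (gen i) n w = G i n w.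

Let Y'_lin n w : islin (fun v => Y' v n w).
Proof. by case: Y'_module. Qed.

(* The two pairings of [u_n v] with the kernels [z^(-q-1) (e^z - 1)^k] agree, and these
   pairings determine the modes. *)
Lemma unique_on_product u v : (forall n w, Y' u n w = Y u n w) ->
  (forall n w, Y' v n w = Y v n w) -> forall s n w, Y' (YV u s v) n w = Y (YV u s v) n w.
Proof.
move=> uY vY s n w; have [_ [_ [_ [_ /(_ u v) [k assoc]]]]] := Y'_module.
have prodE x : prod_coef Y' k u v x = prod_coef YW k u v x.
  apply: funext => p; apply: funext => p'; apply: eq_bigr => i _.
  by rewrite vY uY.
have uvk : local_order k (Y u) (Y v).
  apply: local_order_of_trunc (Y_local u v) _ => x; have [N [hN _]] := assoc x.
  by exists N => p p' hp; rewrite -prod_coefE -prodE hN ?hp.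
have [N [hN assocE]] := assoc w; rewrite prodE in hN assocE.
have [M uvM] := YV_trunc HVA u v.
pose d i := -1 *: Y (YV u i v) n w + Y' (YV u i v) n w.
have YM : upper_trunc M (fun i => Y (YV u i v) n w).
  by move=> i hi; rewrite uvM // (islin0 Y_lin).
have Y'M : upper_trunc M (fun i => Y' (YV u i v) n w).
  by move=> i hi; rewrite uvM // (islin0 (Y'_lin n w)).
suff : d s = 0 by move/eqP; rewrite /d scaleN1r addrC subr_eq0 => /eqP.
apply: (residue_leps_inj (k := k) (M := M)) => [i hi|q].
  by rewrite /d YM // Y'M // scaler0 addr0.
have := assocE M uvM (n + k%:Z) q.
rewrite -(Y_associativity _ _ uvk hN uvM) (assoc_coefE _ _ _ (Y'_lin^~ w) uvM).
rewrite (assoc_coefE _ _ _ (YW_lin^~ w) uvM) addrK => resE.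
by rewrite (residue_linearr _ _ YM Y'M) resE scaleN1r addNr.
Qed.

Theorem Y_unique v n w : Y' v n w = Y v n w.
Proof.
move: n w; apply: (gen_ind (P := fun v => forall n w, Y' v n w = Y v n w))
  => {v} [||i s v hv].
- split=> [|k x y hx hy] n w; first by rewrite (islin0 (Y'_lin n w)) (islin0 Y_lin).
  by rewrite (Y'_lin n w) Y_lin vcoefD vcoefZ hx hy.
- by move=> n w; rewrite Y_vac id_fieldE; case: Y'_module => _ [_ [_ [h _]]]; exact: h.
by apply: unique_on_product => // m x; rewrite Y'_gen Y_gen.
Qed.

End Uniqueness.

End GeneratedModule.

(** * The fields of a restricted module *)

Section RestrictedFields.
Variable W : lmodType C.
Implicit Types (A B D : int -> int -> W -> W) (l : C) (m r n s e t : int) (w : W).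

Definition restricted_family A : Prop := (forall m n, islin (A m n)) /\
  forall m w, exists N, upper_trunc N (fun n => A m n w).

Lemma tz_lin A m n : (forall m n, islin (A m n)) -> islin (tz A m n).
Proof.
move=> A_lin k x y; rewrite /tz; case: ifP => _; first exact: A_lin.
by rewrite scaler0 addr0.
Qed.

Lemma mode_field_is_field A m : restricted_family A ->
  (fun n w => tz A m (- n) w) \in @is_field C W.
Proof.
move=> [A_lin A_trunc]; apply: is_field_intro => [n|w]; first exact: tz_lin.
have [N hN] := A_trunc m w; exists (1 - N) => n hn; rewrite /tz.
by case: ifP => // _; apply: hN; lia.
Qed.

(* [\sum_n A_(m,n) x^(-n)], omitting [A_(0,0)]. *)
Definition mode_field A (hA : restricted_family A) m : vfield W :=
  VField (mode_field_is_field m hA).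

Lemma mode_fieldE A (hA : restricted_family A) m n w : mode_field hA m n w = tz A m (- n) w.
Proof. by []. Qed.

Definition bracket_relation A B D l l' : Prop := forall m n r s w, nz m n -> nz r s ->
  A m n (B r s w) - B r s (A m n w) =
    (n * r - m * s)%:~R *: tz D (m + r) (n + s) w
    + (kd (m + r) 0 * kd (n + s) 0 * (m%:~R * l + n%:~R * l')) *: w.

Lemma nzPn m n : nz m n = false -> m = 0 /\ n = 0.
Proof. by move=> /negbT; rewrite negb_or !negbK => /andP[/eqP -> /eqP ->]. Qed.

Lemma tz_nz A m n w : nz m n -> tz A m n w = A m n w.
Proof. by rewrite /tz => ->. Qed.

Lemma tz00 A w : tz A 0 0 w = 0. Proof. by []. Qed.

Lemma tz_bracket_relation A B D l l' m n r s w :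
  restricted_family A -> restricted_family B -> bracket_relation A B D l l' ->
  tz A m n (tz B r s w) - tz B r s (tz A m n w) =
    (n * r - m * s)%:~R *: tz D (m + r) (n + s) w
    + (kd (m + r) 0 * kd (n + s) 0 * (m%:~R * l + n%:~R * l')) *: w.
Proof.
move=> [A_lin _] [B_lin _] AB.
case mn: (nz m n); last first.
  have [-> ->] := nzPn mn; rewrite !tz00 (islin0 (tz_lin r s B_lin)) subrr.
  by rewrite !mul0r subrr scale0r addr0 mulr0 scale0r addr0.
case rs: (nz r s); last first.
  have [-> ->] := nzPn rs; rewrite !tz00 (islin0 (tz_lin m n A_lin)) !mulr0 !subrr.
  rewrite scale0r add0r !addr0 /kd; move: mn; rewrite /nz.
  case: (m == 0) => /=; last by rewrite !mul0r scale0r.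
  by case: (n == 0) => // _; rewrite mulr0 mul0r scale0r.
by rewrite !(tz_nz _ _ mn, tz_nz _ _ rs) AB.
Qed.

Section Brackets.
Variables (A B D : int -> int -> W -> W) (l l' : C).
Hypotheses (hA : restricted_family A) (hB : restricted_family B) (hD : restricted_family D).
Hypothesis AB : bracket_relation A B D l l'.

Definition bracket_mode m r (j : int) : vfield W :=
  if j == 0 then m%:~R *: euler (mode_field hD (m + r)) + (m%:~R * kd (m + r) 0 * l) *: id_field
  else if j == 1 then (m + r)%:~R *: mode_field hD (m + r) + (kd (m + r) 0 * l') *: id_field
  else 0.

Lemma ad_mode_field m r t :
  ad (mode_field hA m) t (mode_field hB r) = residue (lexp (- t%:~R)) (bracket_mode m r).
Proof.
rewrite /residue (@zsum_ord _ 0 2) => [|j hj]; last first.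
  by rewrite /bracket_mode !ifF ?scaler0 //; lia.
apply: vfieldP => e w; rewrite !big_ord_recl big_ord0 !addr0 add0r adE !mode_fieldE.
rewrite (tz_bracket_relation _ _ _ _ _ hA hB AB) lexp_coef0 lexp_coef1 scale1r.
rewrite !(vcoefD, vcoefZ) eulerE id_fieldE !mode_fieldE (_ : - t - (e - t) = - e); last by lia.
have -> : kd (- e) 0 = kd e 0 by rewrite /kd oppr_eq0.
have -> : (if e == 0 then w else 0) = kd e 0 *: w.
  by rewrite /kd; case: ifP => _; rewrite ?scale1r ?scale0r.
rewrite !scalerDr !scalerA addrACA -scalerDl -(scalerDl w); congr (_ *: _ + _ *: _).
  by rewrite !(rmorphB, rmorphM, rmorphN, rmorphD) /=; ring.
by rewrite rmorphN /=; ring.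
Qed.

Lemma upper_trunc_bracket_mode m r : upper_trunc 2 (bracket_mode m r).
Proof. by move=> j hj; rewrite /bracket_mode !ifF //; lia. Qed.

Lemma local_mode_field m r : local_order 2 (mode_field hA m) (mode_field hB r).
Proof.
rewrite /local_order; under eq_fun do rewrite ad_mode_field -[lexp _]mulr1.
exact: (degree_lt_residue (@upper_trunc_bracket_mode m r) (@order_ge1 C)).
Qed.

Lemma nprodDid k x n (a c : vfield W) : local a c ->
  nprod (k *: a + x *: id_field) n c = k *: nprod a n c + (x * kd (n + 1) 0) *: c.
Proof.
move=> ac; have idc : local id_field c by exact/local_sym/local_id.
rewrite nprod_linearl //; last exact: (submodule_predZ (local_predl c)).
rewrite nprodZl // id_nprod /delta_mode (_ : (n == -1) = (n + 1 == 0)); last by lia.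
rewrite /kd; case: ifP => _; first by rewrite mulr1.
by rewrite mulr0 scaler0 scale0r.
Qed.

Lemma nprod_mode_field_bracket m r n s c :
  local (mode_field hA m) c -> local (mode_field hB r) c -> local (mode_field hD (m + r)) c ->
  nprod (mode_field hA m) n (nprod (mode_field hB r) s c) -
  nprod (mode_field hB r) s (nprod (mode_field hA m) n c) =
    (n * r - m * s)%:~R *: nprod (mode_field hD (m + r)) (n + s - 1) c
    + (m%:~R * kd (m + r) 0 * kd (n + s + 1) 0 * l
       + n%:~R * kd (m + r) 0 * kd (n + s) 0 * l') *: c.
Proof.
move=> Ac Bc Dc; rewrite (nprod_commutator n s (@local_mode_field m r) Ac Bc).
have modeE (j : int) : 0 <= j -> nprod (mode_field hA m) j (mode_field hB r) = bracket_mode m r j.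
  exact: (nprod_eq_of_ad (@upper_trunc_bracket_mode m r) (ad_mode_field m r)).
rewrite !big_ord_recl big_ord0 !addr0 !modeE // /bracket_mode /= (binz0 C) (binz1 C) scale1r.
rewrite !nprodDid //; last exact: local_euler.
rewrite nprod_euler // subrK scalerDr scalerN !scalerA -scaleNr addrACA.
rewrite -[bump 0 0]/1%N -scalerDl -(scalerDl c); move: (nprod _ (_ - 1) c) => p.
rewrite (_ : - (m%:~R * (n + s)%:~R) + n%:~R * (m + r)%:~R = (n * r - m * s)%:~R).
  by congr (_ + _ *: _); ring.
by rewrite !(rmorphB, rmorphM, rmorphD) /=; ring.
Qed.

End Brackets.
End RestrictedFields.

Section LocalFields.
Variables (l1 l2 l3 l4 : C) (W : lmodType C) (tW EW : int -> int -> W -> W).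
Hypotheses (HW : Lstar_module l1 l2 l3 l4 tW EW) (Hres : restricted tW EW).
Implicit Types (m n r s : int) (i : bool * int) (c : vfield W).

Lemma restricted_family_tW : restricted_family tW.
Proof.
split=> [|m w]; first by case: HW.
by have [N hN] := Hres m w; exists N => n /hN[].
Qed.

Lemma restricted_family_EW : restricted_family EW.
Proof.
split=> [|m w]; first by case: HW => _ [].
by have [N hN] := Hres m w; exists N => n /hN[].
Qed.

Definition zero_family m n (w : W) : W := 0.

Lemma restricted_family0 : restricted_family zero_family.
Proof. by split=> [m n k x y|m w]; [rewrite scaler0 addr0|exists 0]. Qed.

Lemma mode_field0 m : mode_field restricted_family0 m = 0.
Proof. by apply: vfieldP => n w; rewrite mode_fieldE /tz if_same. Qed.

Lemma bracket_TT : bracket_relation tW tW zero_family 0 0.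
Proof.
move=> m n r s w mn rs; have [_ [_ [TT _]]] := HW.
by rewrite TT // /tz if_same scaler0 !mulr0 addr0 mulr0 scale0r addr0.
Qed.

Lemma bracket_TE : bracket_relation tW EW tW l1 l2.
Proof. by case: HW => _ [_ [_ []]]. Qed.

Lemma bracket_EE : bracket_relation EW EW EW l3 l4.
Proof. by case: HW => _ [_ [_ []]]. Qed.

Definition generating_field i : vfield W :=
  if i.1 then mode_field restricted_family_tW i.2 else mode_field restricted_family_EW i.2.

Lemma local_generating_field i j : local (generating_field i) (generating_field j).
Proof.
have TE m r : local (generating_field (true, m)) (generating_field (false, r)).
  by exists 2%N; exact: (local_mode_field _ _ restricted_family_tW bracket_TE m r).
case: i j => [[] m] [[] r]; [|exact: TE|exact/local_sym/TE|].
- by exists 2%N; exact: (local_mode_field _ _ restricted_family0 bracket_TT m r).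
by exists 2%N; exact: (local_mode_field _ _ restricted_family_EW bracket_EE m r).
Qed.

Definition generator_local c := forall i, local (generating_field i) c.

Lemma submodule_pred_generator_local : submodule_pred generator_local.
Proof.
split=> [i|k c c' hc hc' i]; first exact: (local_predr _).1.
by apply: (local_predr _).2.
Qed.

Lemma generator_local_nprod i n c :
  generator_local c -> generator_local (nprod (generating_field i) n c).
Proof. by move=> hc j; apply: local_nprodr => //; exact: local_generating_field. Qed.

Notation local_fields := (submodule submodule_pred_generator_local).

Lemma local_field_local (x : local_fields) i :
  local (generating_field i) (submodule_val x).
Proof. exact: (submodule_pred_val x). Qed.

Definition local_field_action i n (x : local_fields) : local_fields :=
  to_submodule _ (generator_local_nprod i n (submodule_pred_val x)).

Lemma local_field_action_linear i n : islin (local_field_action i n).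
Proof.
move=> k x y; apply: submodule_val_inj; rewrite submodule_val_linear /=.
by apply: nprod_linearr; exact: local_field_local.
Qed.

Notation TM := (fun m => local_field_action (true, m)).
Notation EM := (fun m => local_field_action (false, m)).

Theorem local_fields_module : Lhat_module l1 l2 l3 l4 TM EM.
Proof.
have T_local x m := local_field_local x (true, m).
have E_local x m := local_field_local x (false, m).
split; first by move=> m n; exact: local_field_action_linear.
split; first by move=> m n; exact: local_field_action_linear.
split=> [m n r s x|].
  apply: submodule_val_inj; rewrite submodule_valB /=.
  rewrite (nprod_mode_field_bracket (hD := restricted_family0) bracket_TT) /=.
  - by rewrite mode_field0 nprod0l scaler0 !mulr0 addr0 scale0r addr0.
  - exact: T_local.
  - exact: T_local.
  by rewrite mode_field0; exact: (local_predl _).1.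
split=> m n r s x; apply: submodule_val_inj; rewrite submodule_valB /=.
  by apply: (nprod_mode_field_bracket bracket_TE); [exact: T_local|exact: E_local|exact: T_local].
by apply: (nprod_mode_field_bracket bracket_EE); exact: E_local.
Qed.

Lemma generator_local_id : generator_local id_field.
Proof. by move=> i; exact: local_id. Qed.

Lemma nonneg_annihilated_id :
  nonneg_annihilated TM EM (to_submodule submodule_pred_generator_local generator_local_id).
Proof. by move=> m [n|//] _; split; apply: submodule_val_inj; rewrite /= nprod_id. Qed.

Variables (V : lmodType C) (TV EV : int -> int -> V -> V) (vac : V).
Hypothesis HV : vacuum_module l1 l2 l3 l4 TV EV vac.

Lemma vacuum_module_field_map : exists Y : V -> vfield W,
  [/\ islin Y, Y vac = id_field,
      forall i n v, Y (generator_action TV EV i n v) = nprod (generating_field i) n (Y v)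
    & forall i v, local (generating_field i) (Y v)].
Proof.
have [_ [_ univ]] := HV.
have [[f [f_lin [f_vac [f_T f_E]]]] _] := univ _ _ _ _ local_fields_module nonneg_annihilated_id.
exists (fun v => submodule_val (f v)); split=> [k x y|||].
- by rewrite f_lin.
- by rewrite f_vac.
- by move=> [[] m] n v; rewrite /generator_action /= (f_T, f_E).
by move=> i v; exact: local_field_local.
Qed.

End LocalFields.

Theorem theorem4p5 (l1 l2 l3 l4 : C)
    (W : lmodType C) (tW EW : int -> int -> W -> W)
    (HW : Lstar_module l1 l2 l3 l4 tW EW) (Hres : restricted tW EW)
    (V : lmodType C) (TV EV : int -> int -> V -> V) (vac : V)
    (HV : vacuum_module l1 l2 l3 l4 TV EV vac)
    (YV : V -> int -> V -> V) (HVA : vertex_algebra vac YV)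
    (HYT : forall m n v, YV (TV m (-1) vac) n v = TV m n v)
    (HYE : forall m n v, YV (EV m (-1) vac) n v = EV m n v) :
  exists YW : V -> int -> W -> W,
    phi_coordinated_module vac YV YW /\
    generating_fields TV EV vac tW EW YW /\
    (forall YW' : V -> int -> W -> W,
       phi_coordinated_module vac YV YW' ->
       generating_fields TV EV vac tW EW YW' ->
       forall v n w, YW' v n w = YW v n w).
Proof.
pose gen i := generator_action TV EV i (-1) vac.
have gen_action i n v : YV (gen i) n v = generator_action TV EV i n v.
  by case: i => [[] m]; [exact: HYT|exact: HYE].
have gen_ind (P : V -> Prop) : submodule_pred P -> P vac ->
    (forall i n v, P v -> P (YV (gen i) n v)) -> forall v, P v.
  move=> hP Pvac Pact; apply: (vacuum_module_ind HV) => // i n v.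
  by rewrite -gen_action; exact: Pact.
have [Y [Y_lin Y_vac Y_act Y_loc]] := vacuum_module_field_map HW Hres HV.
have Y_action i n v : Y (YV (gen i) n v) = nprod (generating_field HW Hres i) n (Y v).
  by rewrite gen_action.
exists (fun v n w => Y v n w); split; last split.
- exact: (Y_phi_coordinated HVA gen_ind Y_lin Y_vac Y_action Y_loc).
- have Y_gen := Y_gen HVA Y_vac Y_action.
  by move=> m n w; rewrite (Y_gen (true, m)) (Y_gen (false, m)).
move=> YW' YW'_module YW'_gen; apply: (Y_unique HVA gen_ind Y_lin Y_vac Y_action Y_loc) => //.
by case=> [[] m] n w; [exact: (YW'_gen m n w).1|exact: (YW'_gen m n w).2].
Qed.
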